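(* Let $\mathcal{A}\subset\mathbb{Z}_{>0}$ be a finite set (possibly empty) and let $m>2$ be an even integer. Then the following two conditions are equivalent: (1) There exists a positive definite $m$-ic form $Q$ with integer coefficients such that the set of values $\{Q(x) : x\in\mathbb{Z}^n\}$ is exactly $\mathbb{Z}_{\geq 0}\setminus\mathcal{A}$. (2) For all $a,b\in\mathbb{Z}$, if $ab^m\in\mathcal{A}$ then $a\in\mathcal{A}$. Moreover, the form $Q$ in (1) can be chosen to have rank (number of variables) strictly less than $(B+1)(g(m)+1)$, where $B$ is the largest element of $\mathcal{A}$.
   Context: An $m$-ic form in $n$ variables is a homogeneous polynomial of degree $m$ in $x_1,\dots,x_n$; here the coefficients are integers. It is positive definite if $Q(x)>0$ for all $x\in\mathbb{R}^n\setminus\{0\}$. An integer $a$ is represented by $Q$ if $Q(x)=a$ for some $x\in\mathbb{Z}^n$. The rank of $Q$ is its number of variables. $g(m)$ denotes the Waring number: the smallest integer such that every positive integer is a sum of at most $g(m)$ $m$th powers of non-negative integers. *)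

(* Defs.v *)
From mathcomp Require Import all_boot all_order all_algebra.
From mathcomp Require Import finmap mpoly.
From mathcomp Require Import boolp classical_sets reals.

Set Implicit Arguments.
Unset Strict Implicit.
Unset Printing Implicit Defensive.

Import Order.TTheory GRing.Theory Num.Theory.
Local Open Scope ring_scope.

Definition posdef (R : realType) (n : nat) (Q : {mpoly int[n]}) : Prop :=
  forall x : 'I_n -> R,
    (exists i, x i != 0) -> 0 < (map_mpoly (intr : int -> R) Q).@[x].

Definition posdef_form (R : realType) (m n : nat) (Q : {mpoly int[n]}) : Prop :=
  Q \is m.-homog /\ posdef R Q.

Definition values (n : nat) (Q : {mpoly int[n]}) : set int :=
  range (fun x : 'I_n -> int => Q.@[x]).

Definition nonneg_off (A : {fset int}) : set int :=
  [set a : int | 0 <= a /\ a \notin A]%classic.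

Definition sum_of_powers (m g : nat) : Prop :=
  forall N : nat, (0 < N)%N ->
    exists s : seq nat, (size s <= g)%N /\ (\sum_(x <- s) x ^ m)%N = N.

(* The default 0 of [xget] plays no role when 0 < m: by the Hilbert-Waring
   theorem some g satisfies [sum_of_powers m], hence a least one exists. *)
Definition waring (m : nat) : nat :=
  xget 0%N [set g : nat | sum_of_powers m g /\
    forall g' : nat, sum_of_powers m g' -> (g <= g')%N]%classic.

(* For a set of positive integers this is the largest element, and 0 if the
   set is empty. *)
Definition largest (A : {fset int}) : nat := (\max_(a <- A) `|a|)%N.

(* Main.v *)
Require Import Defs.
From HB Require Import structures.
From mathcomp Require Import all_boot all_order all_algebra.
From mathcomp Require Import finmap mpoly.
From mathcomp Require Import boolp classical_sets reals.
From mathcomp Require Import complex polyrcf realalg.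
From mathcomp Require Import zify ring lra.

Set Implicit Arguments.
Unset Strict Implicit.
Unset Printing Implicit Defensive.

Import Order.TTheory GRing.Theory Num.Theory.
Local Open Scope ring_scope.

(** An integer represented by a form [Q] stays represented when multiplied by an
    [m]-th power, which gives (1) -> (2). Conversely let [B] be the largest
    exception. The sums of terms [c x ^ m] with coefficients [B + 1, ...,
    2 B + 1], where [B + 1] is repeated [waring m] times, are [0] and all the
    integers above [B]. Each [a <= B] outside [A] is added as a value by a term
    [a x ^ m], whose values avoid [A] by (2); mixed terms
    [(B + 1) x_i ^ 2 x_j ^ (m - 2)] push above [B] every vector with two nonzero
    such coordinates. This is where [m > 2] is used.

    Since [waring m] must be an actual Waring number, the Hilbert-Waring theorem
    is needed. Its proof follows Hilbert. Gauss-Hermite quadrature, with nodes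
    moved to nearby rationals, yields [M (x^2 + T) ^ n] as a sum of [2n]-th
    powers of linear forms in [x], uniformly in [T]. Taking a coefficient of the
    Taylor expansion in [x] expresses [x ^ 2l U ^ (k - l)], up to a constant
    factor and multiples of [U ^ (k - l + 1)], as a sum of boundedly many [k]-th
    powers, when [x ^ 2 <= U]. By induction the exponents [2l] with [l < k] are
    settled, so that the middle digits in base [U] of a sum of [k]-th powers can
    be prescribed. *)

(** * Four squares *)

Definition four_squares (n : int) : Prop :=
  exists a b c d : int, n = a ^+ 2 + b ^+ 2 + c ^+ 2 + d ^+ 2.

(** Euler's identity, that is, multiplicativity of the norm of quaternions. *)
Lemma four_squaresM (m n : int) :
  four_squares m -> four_squares n -> four_squares (m * n).
Proof.
move=> [a [b [c [d ->]]]] [x [y [z [t ->]]]].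
exists (a * x + b * y + c * z + d * t), (a * y - b * x + c * t - d * z),
  (a * z - b * t - c * x + d * y), (a * t + b * z - c * y - d * x).
ring.
Qed.

Lemma centered_remainder (m a : int) : 0 < m ->
  exists t r : int, [/\ a = r + m * t, - m < 2 * r & 2 * r <= m].
Proof.
move=> m_gt0.
have := divz_eq a m; have := modz_ge0 a (lt0r_neq0 m_gt0).
have := ltz_pmod a m_gt0; move: (a %/ m)%Z (a %% m)%Z => q s lt_sm s_ge0 ->.
case: (lerP (2 * s) m) => [le_sm|lt_ms].
  by exists q, s; split; lia.
by exists (q + 1), (s - m); split; lia.
Qed.

(** Fermat descent on [m]. Reducing the four roots modulo [m] to remainders of least absolute value
    gives a sum of squares [m m'] with [0 < m' < m], and Euler's identity, divided by [m ^ 2],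
    represents [m' p]. *)
Lemma four_squares_descent (p : nat) (m : int) : prime p ->
  0 < m < p%:Z -> four_squares (m * p%:Z) -> four_squares p%:Z.
Proof.
move=> p_pr; move: m; have Pm (k : nat) (m : int) : m <= k%:Z ->
  0 < m < p%:Z -> four_squares (m * p%:Z) -> four_squares p%:Z; last first.
  by move=> m m_bd; apply: (Pm `|m|%N) => //; lia.
elim: k m => [|k IHk] m le_mk /andP[m_gt0 lt_mp]; first by lia.
move=> [a [b [c [d eq_mp]]]].
have [m1|m_neq1] := eqVneq m 1; first by rewrite m1 mul1r in eq_mp; exists a, b, c, d.
have m_ndvd x : p%:Z <> m * x.
  move=> eq_p; have: (`|m| %| p)%N by apply/dvdnP; exists `|x|%N; lia.
  by move: p_pr => /primeP[_ /[apply]] /orP[] /eqP; lia.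
have [ta [ra [ea la ua]]] := centered_remainder a m_gt0.
have [tb [rb [eb lb ub]]] := centered_remainder b m_gt0.
have [tc [rc [ec lc uc]]] := centered_remainder c m_gt0.
have [td [rd [ed ld ud]]] := centered_remainder d m_gt0.
pose S := a * ta + b * tb + c * tc + d * td.
pose T := ta ^+ 2 + tb ^+ 2 + tc ^+ 2 + td ^+ 2.
(* Obtained by expanding the squares of the remainders [a - m ta], ..., [d - m td] and dividing by
   [m]. *)
pose m' := p%:Z - 2 * S + m * T.
have mm' : m * m' = ra ^+ 2 + rb ^+ 2 + rc ^+ 2 + rd ^+ 2.
  have -> : m * m' = m * p%:Z - 2 * m * S + m ^+ 2 * T by rewrite /m'; ring.
  rewrite eq_mp /S /T ea eb ec ed; ring.
have r_bd (r : int) : - m < 2 * r -> 2 * r <= m ->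
    [/\ 0 <= r ^+ 2, 4 * r ^+ 2 <= m ^+ 2 & m ^+ 2 <= 4 * r ^+ 2 -> m = 2 * r].
  by clear -m_gt0 => lr ur; split; [exact: sqr_ge0 | nia | nia].
have [sa qa wa] := r_bd _ la ua; have [sb qb wb] := r_bd _ lb ub.
have [sc qc wc] := r_bd _ lc uc; have [sd qd wd] := r_bd _ ld ud.
have sum4 (q x y z t : int) : 0 <= x -> 0 <= y -> 0 <= z -> 0 <= t ->
    4 * x <= q -> 4 * y <= q -> 4 * z <= q -> 4 * t <= q ->
  [/\ 0 <= x + y + z + t <= q,
      x + y + z + t = 0 -> [/\ x = 0, y = 0, z = 0 & t = 0] &
      x + y + z + t = q -> [/\ q <= 4 * x, q <= 4 * y, q <= 4 * z & q <= 4 * t]].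
  by clear=> *; split; [lia | move=> ?; split; lia | move=> ?; split; lia].
have [/andP[sum_ge0 sum_le] sum0 sum_max] := sum4 _ _ _ _ _ sa sb sc sd qa qb qc qd.
have m'_ge0 : 0 <= m' by rewrite -(pmulr_rge0 _ m_gt0) mm'.
have m'_neq0 : m' != 0.
  apply/eqP => m'0; move: mm'; rewrite m'0 mulr0 => /esym/sum0.
  have z (r : int) : r ^+ 2 = 0 -> r = 0 by move/eqP; rewrite sqrf_eq0 => /eqP.
  case=> /z za /z zb /z zc /z zd.
  apply: (m_ndvd T); apply: (mulfI (lt0r_neq0 m_gt0)).
  by rewrite eq_mp ea eb ec ed za zb zc zd /T; ring.
(* Equality would force all four remainders to be [m / 2], and then [m] would divide [p]. *)
have le_m'm : m' <= m by rewrite -(ler_pM2l m_gt0) mm' -expr2.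
have m'_neqm : m' != m.
  apply/eqP => m'm; move: mm'; rewrite m'm -expr2 => sm.
  case: (sum_max (esym sm)) => /wa za /wb zb /wc zc /wd zd.
  apply: (m_ndvd (1 + (ta + tb + tc + td) + T)).
  apply: (mulfI (lt0r_neq0 m_gt0)); rewrite eq_mp.
  have -> : m * (m * (1 + (ta + tb + tc + td) + T)) =
    m ^+ 2 + m * m * ta + m * m * tb + m * m * tc + m * m * td + m ^+ 2 * T by ring.
  rewrite {1}sm {1}za {2}zb {3}zc {4}zd ea eb ec ed /T; ring.
apply: (IHk m').
- by clear -le_m'm m'_neqm le_mk; lia.
- by clear -le_m'm m'_ge0 m'_neq0 lt_mp; lia.
(* Up to signs, the quaternion product of the roots with their remainders, divided by [m]. *)
exists (p%:Z - S), (a * tb - b * ta + c * td - d * tc),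
  (a * tc - b * td - c * ta + d * tb), (a * td + b * tc - c * tb - d * ta).
have -> : m' * p%:Z = p%:Z ^+ 2 - 2 * p%:Z * S + (m * p%:Z) * T by rewrite /m'; ring.
by rewrite eq_mp /S /T; ring.
Qed.

(** Pigeonhole: for [i <= p / 2] the squares [i ^ 2] are distinct modulo [p], and so are the
    [- 1 - i ^ 2]. Together these are more than [p] residues, so the two sets meet. *)
Lemma dvdn_sum_two_squares_S (p : nat) : prime p ->
  exists a b : nat, [/\ (a <= p./2)%N, (b <= p./2)%N & (p %| a ^ 2 + b ^ 2 + 1)%N].
Proof.
move=> p_pr; pose h := p./2.
have p_odd : (h + h <= p)%N by rewrite /h -{3}(odd_double_half p) -addnn leq_addl.
have inj_sqr (i j : 'I_h.+1) : (i%:R ^+ 2 : 'F_p) = j%:R ^+ 2 -> i = j.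
  have wl (k l : 'I_h.+1) : (l <= k)%N -> (k%:R ^+ 2 : 'F_p) = l%:R ^+ 2 -> k = l.
    move=> le_lk /eqP; rewrite -subr_eq0 subr_sqr -natrB // -natrD -natrM.
    rewrite -(dvdn_pcharf (pchar_Fp p_pr)) Euclid_dvdM // => /orP dvd_p.
    apply: val_inj => /=; have := ltn_ord k; have := ltn_ord l.
    by case: dvd_p => /dvdnP[[|q] eq_q] /=; nia.
  case: (leqP j i) => [le_ji /(wl _ _ le_ji) //|/ltnW le_ij eq_ij].
  by rewrite (wl _ _ le_ij).
pose f (i : 'I_h.+1) : 'F_p := i%:R ^+ 2.
pose g (i : 'I_h.+1) : 'F_p := - 1 - i%:R ^+ 2.
have cf : #|f @: 'I_h.+1| = h.+1 by rewrite card_imset ?card_ord.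
have cg : #|g @: 'I_h.+1| = h.+1.
  rewrite card_imset ?card_ord // => i j /addrI/oppr_inj; exact: inj_sqr.
have : (0 < #|f @: 'I_h.+1 :&: g @: 'I_h.+1|)%N.
  have := cardsUI (f @: 'I_h.+1) (g @: 'I_h.+1); rewrite cf cg.
  have := max_card (f @: 'I_h.+1 :|: g @: 'I_h.+1); rewrite card_Fp //.
  have := odd_double_half p; rewrite -/h.
  move: (odd p) #|_ :|: _| #|_ :&: _| => o; clear; lia.
case/card_gt0P => z /finset.setIP[/imsetP[i _ ->] /imsetP[j _ fg]].
exists i, j; split; [exact: ltn_ord i | exact: ltn_ord j | ].
rewrite (dvdn_pcharf (pchar_Fp p_pr)) !natrD !natrX.
by move: fg; rewrite /f /g => ->; rewrite subrK addNr.
Qed.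

(** Strong induction splits off the least prime factor [p]. The descent starts from the multiple
    [a ^ 2 + b ^ 2 + 1] of [p], which is below [p ^ 2] because [a, b <= p / 2]. *)
Theorem lagrange_four_squares (n : nat) : four_squares n%:Z.
Proof.
elim/ltn_ind: n => n IHn; have [|n_gt1] := leqP n 1.
  case: n IHn => [|[|//]] _ _; first by exists 0, 0, 0, 0.
  by exists 1, 0, 0, 0.
have p_pr := pdiv_prime n_gt1; have /dvdnP[q eq_n] := pdiv_dvd n.
have p_gt1 := prime_gt1 p_pr.
have lt_qn : (q < n)%N by nia.
rewrite {1}eq_n PoszM; apply: four_squaresM; first exact: IHn.
have [a [b [le_a le_b /dvdnP[m eq_m]]]] := dvdn_sum_two_squares_S p_pr.
apply: (@four_squares_descent _ m%:Z p_pr); last first.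
  by exists a%:Z, b%:Z, 1, 0; rewrite -PoszM -eq_m; lia.
move: (pdiv n) p_gt1 le_a le_b eq_m => p p_gt1 le_a le_b eq_m.
have := odd_double_half p => eq_p.
have a2 : (4 * a ^ 2 <= p ^ 2)%N by nia.
have b2 : (4 * b ^ 2 <= p ^ 2)%N by nia.
by apply/andP; split; nia.
Qed.

(** * Gauss-Hermite quadrature *)

(* Moments of the centred Gaussian of variance 2; the even ones are
   [(2 i)! / i!]. *)
Fixpoint gauss_moment (n : nat) : nat :=
  match n with
  | 0 => 1
  | 1 => 0
  | (k.+1 as k').+1 => 2 * k' * gauss_moment k
  end.

Arguments gauss_moment : simpl never.

Lemma gauss_momentSS (n : nat) :
  gauss_moment n.+2 = (2 * n.+1 * gauss_moment n)%N.
Proof. by []. Qed.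

(** * Gaussian mean of a polynomial *)

Section MomentFunctional.
Variable F : comNzRingType.
Implicit Types p q : {poly F}.

(** Expectation under the Gaussian weight, given by its moments so that it makes sense over any
    commutative ring. *)
Definition gauss_mean p : F := \sum_(i < size p) p`_i * (gauss_moment i)%:R.

Lemma gauss_mean_widen (n : nat) p : (size p <= n)%N ->
  gauss_mean p = \sum_(i < n) p`_i * (gauss_moment i)%:R.
Proof.
move=> le_pn; rewrite /gauss_mean (big_ord_widen n (fun i => p`_i * (gauss_moment i)%:R)) //.
rewrite big_mkcond; apply: eq_bigr => i _; case: ltnP => // le_pi.
by rewrite nth_default ?mul0r.
Qed.

Lemma gauss_mean_is_linear (a : F) p q :
  gauss_mean (a *: p + q) = a * gauss_mean p + gauss_mean q.
Proof.
pose n := maxn (size p) (size q).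
have le_n : (size (a *: p + q)%R <= n)%N.
  rewrite (leq_trans (size_polyD _ _)) // geq_max leq_maxr andbT.
  by rewrite (leq_trans (size_scale_leq _ _)) ?leq_maxl.
rewrite !(@gauss_mean_widen n) ?leq_maxl ?leq_maxr // mulr_sumr -big_split /=.
by apply: eq_bigr => i _; rewrite coefD coefZ mulrDl mulrA.
Qed.

HB.instance Definition _ :=
  GRing.isLinear.Build F {poly F} F _ gauss_mean gauss_mean_is_linear.

Lemma gauss_meanXn (n : nat) : gauss_mean 'X^n = (gauss_moment n)%:R.
Proof.
rewrite (@gauss_mean_widen n.+1) ?size_polyXn // big_ord_recr /= coefXn eqxx mul1r.
by rewrite big1 ?add0r // => i _; rewrite coefXn ltn_eqF ?mul0r.
Qed.

(* Integration by parts against the Gaussian weight. *)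
Lemma gauss_mean_mulX p : gauss_mean ('X * p) = 2 * gauss_mean p^`().
Proof.
rewrite -[p]coefK poly_def mulr_sumr !linear_sum /= mulr_sumr.
apply: eq_bigr => i _; rewrite -scalerAr !linearZ /= -exprS gauss_meanXn derivXn.
rewrite raddfMn /= mulrCA; congr (_ * _).
case: {i}(i : nat) => [|n]; first by rewrite mulr0n mulr0.
by rewrite gauss_meanXn !natrM -mulr_natr; ring.
Qed.

End MomentFunctional.

Lemma gauss_mean_map (F G : comNzRingType) (f : {rmorphism F -> G}) (p : {poly F}) :
  gauss_mean (map_poly f p) = f (gauss_mean p).
Proof.
rewrite (@gauss_mean_widen _ (size p)) ?size_poly // /gauss_mean rmorph_sum /=.
by apply: eq_bigr => i _; rewrite coef_map rmorphM rmorph_nat.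
Qed.

(** * Hermite polynomials and their orthogonality *)

Section Hermite.
Variable F : realFieldType.
Implicit Types p q : {poly F}.

(** Monic Hermite polynomials for variance 2. By integration by parts the operator [X - 2 d/dX] is
    the adjoint of [2 d/dX], so moving it across [n] times differentiates the other factor [n]
    times. *)
Fixpoint hermite (n : nat) : {poly F} :=
  if n is k.+1 then 'X * hermite k - 2 *: (hermite k)^`() else 1.

Lemma hermite_monic_size (n : nat) :
  hermite n \is monic /\ size (hermite n) = n.+1.
Proof.
elim: n => [|n [mon_n sz_n]] /=; first by rewrite monic1 size_poly1.
have sz_lt : (size (- (2 *: (hermite n)^`()))%R < size ('X * hermite n)%R)%N.
  rewrite size_polyN mulrC size_mulX -?size_poly_eq0 sz_n // ltnS.
  rewrite (leq_trans (size_scale_leq _ _)) // (leq_trans (size_poly _ _)) //.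
  by rewrite sz_n.
split; last by rewrite size_polyDl // mulrC size_mulX -?size_poly_eq0 sz_n.
by rewrite monicE lead_coefDl // -monicE monicMr ?monicX.
Qed.

Lemma hermite_monic (n : nat) : hermite n \is monic.
Proof. by case: (hermite_monic_size n). Qed.

Lemma size_hermite (n : nat) : size (hermite n) = n.+1.
Proof. by case: (hermite_monic_size n). Qed.

Lemma gauss_mean_hermite (n : nat) q :
  gauss_mean (hermite n * q) = 2 ^+ n * gauss_mean q^`(n).
Proof.
elim: n q => [|n IHn] q; first by rewrite !mul1r.
rewrite [hermite _]/= mulrBl -mulrA raddfB /= gauss_mean_mulX derivM -scalerAl.
rewrite raddfD linearZ /= mulrDr [X in X + _]addrC addrK IHn -derivSn.
by rewrite mulrA exprS.
Qed.

Lemma hermite_orthogonal (n : nat) q :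
  (size q <= n)%N -> gauss_mean (hermite n * q) = 0.
Proof.
by move=> le_qn; rewrite gauss_mean_hermite derivn_poly0 // raddf0 mulr0.
Qed.

Lemma gauss_mean_hermite_sqr (n : nat) : 0 < gauss_mean (hermite n * hermite n).
Proof.
rewrite gauss_mean_hermite mulr_gt0 ?exprn_gt0 //.
have sz : (size (hermite n)^`(n) <= 1)%N.
  by apply/leq_sizeP => i lt_i; rewrite coef_derivn nth_default ?mul0rn // size_hermite; lia.
rewrite (size1_polyC sz) coef_derivn addn0 ffactnn.
have -> : (hermite n)`_n = 1.
  by have /monicP := hermite_monic n; rewrite lead_coefE size_hermite.
rewrite -(mulr1 (1 *+ _)%:P) mul_polyC linearZ /= -(expr0 'X) gauss_meanXn mulr1.
by rewrite ltr0n fact_gt0.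
Qed.

(** Induction on the degree: the top Hermite component of [p] is orthogonal to the remainder [r], so
    the mean of [p ^ 2] is a positive term plus the mean of [r ^ 2]. *)
Lemma gauss_mean_sqr_gt0 p : p != 0 -> 0 < gauss_mean (p * p).
Proof.
have [n] := ubnP (size p); elim: n p => // n IHn p; rewrite ltnS => le_pn p_neq0.
pose k := (size p).-1; pose c := lead_coef p; pose r := p - c *: hermite k.
have sz_p : size p = k.+1 by rewrite prednK // lt0n size_poly_eq0.
have sz_r : (size r <= k)%N.
  apply/leq_sizeP => i le_ki; rewrite coefB coefZ.
  have [->|lt_ki] : i = k \/ (k < i)%N by lia.
    have /monicP := hermite_monic k; rewrite lead_coefE size_hermite /= => ->.
    by rewrite mulr1 /c lead_coefE subrr.
  by rewrite !nth_default ?mulr0 ?subr0 ?size_hermite ?sz_p.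
have p_eq : p * p = (c * c) *: (hermite k * hermite k) +
    (2 * c) *: (hermite k * r) + r * r.
  have -> : p = c *: hermite k + r by rewrite addrC subrK.
  rewrite -!mul_polyC !polyCM; ring.
have c2_gt0 : 0 < c * c by rewrite -expr2 exprn_even_gt0 //= lead_coef_eq0.
rewrite p_eq 2!linearD !linearZ /= (hermite_orthogonal sz_r) mulr0 addr0.
rewrite ltr_wpDr //; last exact: (mulr_gt0 c2_gt0 (gauss_mean_hermite_sqr k)).
have [->|r_neq0] := eqVneq r 0; first by rewrite mul0r raddf0.
by apply/ltW/IHn => //; rewrite (leq_ltn_trans sz_r) // -sz_p.
Qed.

(* Otherwise [hermite n] is orthogonal to [g], of lower degree, although the
   product [((X - a)^2 + b^2) g^2] has positive mean. *)
Lemma hermite_no_quadratic_factor (n : nat) (a b : F) (g : {poly F}) :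
  hermite n <> (('X - a%:P) ^+ 2 + (b ^+ 2)%:P) * g.
Proof.
move=> eq_h; have h_neq0 : hermite n != 0 by rewrite monic_neq0 ?hermite_monic.
have g_neq0 : g != 0 by apply: contra_neq h_neq0 => g0; rewrite eq_h g0 mulr0.
have mon : ('X - a%:P) ^+ 2 + (b ^+ 2)%:P \is monic.
  rewrite monicE lead_coefDl -?monicE ?monic_exp ?monicXsubC //.
  by rewrite size_exp_XsubC (leq_ltn_trans (size_polyC_leq1 _)).
have le_gn : (size g <= n)%N.
  have := size_hermite n; rewrite eq_h mulrC size_Mmonic // size_polyDl ?size_exp_XsubC.
    by lia.
  by rewrite (leq_ltn_trans (size_polyC_leq1 _)).
have := hermite_orthogonal le_gn; apply/eqP; rewrite gt_eqF // eq_h.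
have -> : (('X - a%:P) ^+ 2 + (b ^+ 2)%:P) * g * g =
  (('X - a%:P) * g) * (('X - a%:P) * g) + b ^+ 2 *: (g * g).
  by rewrite -mul_polyC; ring.
rewrite linearD linearZ /= ltr_wpDr //.
  by rewrite mulr_ge0 ?sqr_ge0 // ltW // gauss_mean_sqr_gt0.
by rewrite gauss_mean_sqr_gt0 // mulf_neq0 ?polyXsubC_eq0.
Qed.

End Hermite.

(** The excluded factors with [b != 0] are those of conjugate pairs of non-real roots; those with
    [b = 0] come from double roots. *)
Lemma real_rooted_split (R : rcfType) (p : {poly R}) : p \is monic ->
    (forall a b g, p <> (('X - a%:P) ^+ 2 + (b ^+ 2)%:P) * g) ->
  exists2 s : seq R, uniq s & p = \prod_(x <- s) ('X - x%:P).
Proof.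
have [n] := ubnP (size p); elim: n p => // n IHn p.
rewrite ltnS => le_pn p_mon p_nodiv.
have [sz1|sz_neq1] := eqVneq (size p) 1%N.
  exists [::] => //; rewrite big_nil.
  have p_eq := size1_polyC (eq_leq sz1); rewrite p_eq.
  by move: p_mon; rewrite monicE lead_coefE sz1 /= => /eqP ->.
have [z pz0] : exists z : R[i], root (map_poly (real_complex R) p) z.
  by apply/closed_rootP; rewrite size_map_poly.
have [a pa0] : exists a, root p a.
  case: z pz0 => a b; have [->|b_neq0] := eqVneq b 0.
    by rewrite -[Complex a 0]/(real_complex R a) fmorph_root => pa0; exists a.
  move=> pz0; exfalso; pose d := ('X - a%:P) ^+ 2 + (b ^+ 2)%:P.
  have sz_b : (size (b ^+ 2)%:P < size (('X - a%:P) ^+ 2))%N.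
    by rewrite size_exp_XsubC (leq_ltn_trans (size_polyC_leq1 _)).
  have sz_d : size d = 3 by rewrite size_polyDl // size_exp_XsubC.
  have d_neq0 : d != 0 by rewrite -size_poly_eq0 sz_d.
  have dz0 : root (map_poly (real_complex R) d) (Complex a b).
    rewrite rmorphD rmorphXn /= map_polyXsubC map_polyC /root !hornerE.
    by apply/eqP; simpc; congr Complex; ring.
  apply: (p_nodiv a b (p %/ d)); rewrite -/d mulrC {1}(divp_eq p d).
  suff -> : p %% d = 0 by rewrite addr0.
  have := ltn_modp p d; rewrite d_neq0 sz_d; set r := p %% d => sz_r.
  have : root (map_poly (real_complex R) r) (Complex a b).
    move: pz0; rewrite {1}(divp_eq p d) rmorphD rmorphM /= /root hornerD hornerM.
    by rewrite (eqP dz0) mulr0 add0r.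
  (* A real polynomial of degree at most 1 with a non-real root is zero. *)
  have r_eq : r = r`_1 *: 'X + (r`_0)%:P.
    apply/polyP => i; rewrite coefD coefZ coefX coefC.
    case: i => [|[|i]] /=; rewrite ?mulr0 ?mulr1 ?add0r ?addr0 //.
    by apply: nth_default; apply: leq_trans (sz_r : (size r <= 2)%N) _.
  rewrite r_eq rmorphD /= map_polyZ map_polyX map_polyC /root !hornerE /=.
  simpc; rewrite eq_complex /= => /andP[/eqP re /eqP im].
  have r1 : r`_1 = 0.
    apply/eqP; move/eqP: im; rewrite ?addr0 ?mul0r ?mulf_eq0 (negPf b_neq0) ?orbF //.
  by move: re; rewrite r1 scale0r !mul0r ?add0r => ->.
have /factor_theorem[q p_eq] := pa0.
have q_mon : q \is monic by move: p_mon; rewrite p_eq monicMr ?monicXsubC.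
have sz_p : size p = (size q).+1.
  by rewrite p_eq size_Mmonic ?monicXsubC ?monic_neq0 // size_XsubC addn2.
have [||s s_uniq q_eq] := IHn q _ q_mon; first by rewrite -sz_p.
  by move=> c b g q_eq; apply: (p_nodiv c b (g * ('X - a%:P))); rewrite p_eq q_eq mulrA.
exists (a :: s); last by rewrite big_cons p_eq q_eq mulrC.
rewrite /= s_uniq andbT; apply/negP => /(nthP 0) [i lt_i s_i].
have : root q a by rewrite q_eq root_prod_XsubC -s_i mem_nth.
move=> /factor_theorem[g q_eq']; apply: (p_nodiv a 0 g).
by rewrite p_eq q_eq' expr0n /= addr0; ring.
Qed.

(** By continuity all the polynomials stay positive within some [e] of [x]; the rational
    [floor (N x) / N] with [N > 1 / e] lies there. *)
Lemma poly_pos_rat_approx (R : archiRcfType) (ps : seq {poly R}) (x : R) :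
    (forall p, p \in ps -> 0 < p.[x]) ->
  exists q : rat, forall p, p \in ps -> 0 < p.[ratr q].
Proof.
move=> ps_gt0.
have [e e_gt0 e_ps] : exists2 e, 0 < e &
    forall p y, p \in ps -> `|y - x| < e -> 0 < p.[y].
  elim: ps ps_gt0 => [|p ps IHps] ps_gt0; first by exists 1.
  have [e e_gt0 e_ps] : exists2 e, 0 < e &
    forall p y, p \in ps -> `|y - x| < e -> 0 < p.[y].
    by apply: IHps => q q_ps; rewrite ps_gt0 ?inE ?q_ps ?orbT.
  have [d d_gt0 d_p] := poly_cont x p (ps_gt0 p (mem_head _ _)).
  exists (Num.min d e) => [|q y]; first by rewrite lt_min d_gt0.
  rewrite inE lt_min => /predU1P[->|q_ps] /andP[lt_d lt_e]; last exact: e_ps.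
  by have := d_p y lt_d; rewrite ltr_norml => /andP[+ _]; rewrite ltrBrDl subrr.
pose N := (Num.bound e^-1); have lt_N : e^-1 < N%:R.
  by rewrite archi_boundP // invr_ge0 ltW.
have N_gt0 : 0 < N%:R :> R by rewrite (lt_trans _ lt_N) // invr_gt0.
exists ((Num.floor (N%:R * x))%:~R / N%:R) => p p_ps; apply: e_ps => //.
rewrite rmorphM fmorphV /= ratr_int ratr_nat -(ltr_pM2r N_gt0).
rewrite -[X in _ * X < _](gtr0_norm N_gt0) -normrM mulrBl divfK ?gt_eqF // [x * _]mulrC.
have /andP[] := floor_itv (N%:R * x); rewrite intrD => le1 lt1.
have lt_eN : 1 < e * N%:R by rewrite -(ltr_pdivrMl _ _ e_gt0) mulr1.
by apply: le_lt_trans lt_eN; rewrite ler_norml; apply/andP; split; lra.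
Qed.

(** * Quadrature with positive weights *)

Section Quadrature.
Variable F : realFieldType.
Implicit Types s : seq F.

(* Equivalently: the interpolatory quadrature rule with nodes [s] has positive
   weights; the weight at [x] is the quotient of the two factors. *)
Definition positive_nodes s := forall x, x \in s ->
  let q := \prod_(y <- rem x s) ('X - y%:P) in 0 < gauss_mean q * q.[x].

Lemma perm_positive_nodes s1 s2 :
  perm_eq s1 s2 -> positive_nodes s1 -> positive_nodes s2.
Proof.
move=> eq_s pos_s1 x x_s2; have x_s1 : x \in s1 by rewrite (perm_mem eq_s).
suff eq_rem : perm_eq (rem x s1) (rem x s2).
  by rewrite /= -(perm_big _ eq_rem); apply: pos_s1.
rewrite -(perm_cons x) -(permPl (perm_to_rem x_s1)) (permPl eq_s).
exact: perm_to_rem.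
Qed.

Lemma positive_nodes_notin_rem s x :
  positive_nodes s -> x \in s -> x \notin rem x s.
Proof.
move=> pos_s x_s; apply/negP => x_rem; have := pos_s x x_s.
by rewrite -root_prod_XsubC in x_rem; rewrite /= (eqP x_rem) mulr0 ltxx.
Qed.

Lemma positive_nodes_uniq s : positive_nodes s -> uniq s.
Proof.
move=> pos_s; apply: count_mem_uniq => x; case: (boolP (x \in s)) => [x_s|/count_memPn //].
rewrite (permP (perm_to_rem x_s)) /= eqxx.
by rewrite (count_memPn (positive_nodes_notin_rem pos_s x_s)).
Qed.

(* With [q] the product over the other nodes, [q^2 - q(x) q] is a multiple of
   [hermite n] by a factor of lower degree, hence has mean zero. *)
Lemma hermite_positive_nodes (n : nat) s : uniq s ->
  hermite F n = \prod_(x <- s) ('X - x%:P) -> positive_nodes s.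
Proof.
move=> s_uniq eq_h x x_s; set q := \prod_(y <- _) _.
have h_eq : hermite F n = ('X - x%:P) * q.
  by rewrite eq_h (perm_big _ (perm_to_rem x_s)) big_cons.
have q_mon : q \is monic by rewrite monic_prod // => y _; apply: monicXsubC.
have sz_q : size q = n.
  have := size_hermite F n; rewrite h_eq mulrC size_Mmonic ?monic_neq0 ?monicXsubC //.
  by rewrite size_XsubC addn2 => -[].
have /factor_theorem[k k_eq] : root (q - q.[x]%:P) x.
  by rewrite /root !hornerE subrr.
have sz_k : (size k <= n)%N.
  have [->|k_neq0] := eqVneq k 0; first by rewrite size_poly0.
  have : (size (q - q.[x]%:P)%R <= maxn n 1)%N.
    by rewrite (leq_trans (size_polyD _ _)) // size_polyN sz_q geq_max leq_maxl
      (leq_trans (size_polyC_leq1 _)) ?leq_maxr.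
  rewrite k_eq size_Mmonic ?monicXsubC // size_XsubC addn2 /=.
  case: (posnP n) => [n0|]; last by lia.
  by have := monic_neq0 q_mon; rewrite -size_poly_eq0 sz_q n0.
have := hermite_orthogonal sz_k.
have -> : hermite F n * k = q * q - q.[x] *: q.
  by rewrite h_eq -mul_polyC mulrAC [_ * k]mulrC -k_eq; ring.
rewrite linearB linearZ /= => /eqP; rewrite subr_eq0 [_ * gauss_mean _]mulrC => /eqP <-.
by rewrite gauss_mean_sqr_gt0 ?monic_neq0.
Qed.

(** Lagrange interpolation at the nodes, followed by taking means. The sign of a quotient is that of
    the product, hence positive weights. *)
Lemma positive_nodes_quadrature s : positive_nodes s ->
  exists2 w : F -> F, forall x, x \in s -> 0 < w x &
    forall p : {poly F}, (size p <= size s)%N ->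
      gauss_mean p = \sum_(x <- s) w x * p.[x].
Proof.
move=> pos_s; have s_uniq := positive_nodes_uniq pos_s.
pose q x := \prod_(y <- rem x s) ('X - y%:P).
have q_pos x : x \in s -> 0 < gauss_mean (q x) * (q x).[x] by apply: pos_s.
have q_neq0 x : x \in s -> (q x).[x] != 0.
  by move/q_pos; apply: contraTneq => ->; rewrite mulr0 ltxx.
exists (fun x => gauss_mean (q x) / (q x).[x]) => [x x_s|p le_p].
  have q2_gt0 : 0 < (q x).[x] ^+ 2 by rewrite exprn_even_gt0 //= q_neq0.
  by rewrite -(pmulr_lgt0 _ q2_gt0) expr2 mulrA divfK ?q_pos ?q_neq0.
have p_eq : p = \sum_(x <- s) (p.[x] / (q x).[x]) *: q x.
  apply/eqP; rewrite -subr_eq0; apply/eqP; apply: (roots_geq_poly_eq0 _ s_uniq).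
    apply/allP => y y_s; rewrite /root hornerD hornerN horner_sum (big_rem y) //=.
    rewrite hornerZ divfK ?q_neq0 // big_seq big1 ?addr0 ?subrr // => x.
    rewrite mem_rem_uniq // => /andP[x_neqy x_s].
    rewrite hornerZ; suff /eqP -> : root (q x) y by rewrite mulr0.
    by rewrite root_prod_XsubC mem_rem_uniq // inE y_s eq_sym x_neqy.
  rewrite (leq_trans (size_polyD _ _)) // geq_max le_p size_polyN.
  rewrite big_seq; apply: (leq_trans (size_sum _ _ _)); apply/bigmax_leqP_seq => x x_s _.
  rewrite (leq_trans (size_scale_leq _ _)) // size_prod_XsubC size_rem //.
  by case: (s) x_s.
rewrite {1}p_eq linear_sum; apply: eq_bigr => x _.
by rewrite linearZ /= mulrC mulrA mulrAC.
Qed.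

End Quadrature.

(** * Moving the nodes to rationals and clearing denominators *)

Lemma map_rem (T U : eqType) (f : T -> U) (x : T) (s : seq T) :
  injective f -> map f (rem x s) = rem (f x) (map f s).
Proof.
move=> f_inj; elim: s => //= y s IHs.
by rewrite (inj_eq f_inj); case: eqP => //= _; rewrite IHs.
Qed.

Lemma positive_nodes_ratr (R : realFieldType) (s : seq rat) :
  positive_nodes (map ratr s : seq R) -> positive_nodes s.
Proof.
move=> pos_s x x_s; have := pos_s (ratr x) (map_f _ x_s).
rewrite -map_rem; last exact: fmorph_inj.
rewrite big_map; set q := \prod_(y <- _) _.
have -> : q = map_poly ratr (\prod_(y <- rem x s) ('X - y%:P)).
  by rewrite rmorph_prod; apply: eq_bigr => y _ /=; rewrite map_polyXsubC.
by rewrite /= gauss_mean_map horner_map -rmorphM ltr0q.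
Qed.

(** With the nodes in [t] fixed, each positivity condition is a strict polynomial inequality in the
    remaining node, so it persists at some rational. *)
Lemma positive_nodes_perturb (R : archiRcfType) (x : R) (t : seq R) :
  positive_nodes (x :: t) -> exists q : rat, positive_nodes (ratr q :: t).
Proof.
move=> pos_xt; have /andP[x_notin t_uniq] := positive_nodes_uniq pos_xt.
pose q0 := \prod_(y <- t) ('X - y%:P).
pose q y := \prod_(z <- rem y t) ('X - z%:P).
(* [P0] expresses the condition at the moving node, and [P y] the condition at the fixed node [y],
   as polynomials in the moving node. *)
pose P0 := gauss_mean q0 *: q0.
pose P y := ((gauss_mean ('X * q y))%:P - gauss_mean (q y) *: 'X) *
  (y%:P - 'X) * (q y).[y]%:P.
have P_eq y z : gauss_mean (('X - z%:P) * q y) * (('X - z%:P) * q y).[y] = (P y).[z].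
  rewrite mulrBl linearB /= mul_polyC linearZ /= /P !hornerE; ring.
have [p|r r_pos] := @poly_pos_rat_approx R (P0 :: map P t) x.
  rewrite inE => /predU1P[->|/mapP[y y_t ->]].
    by have := pos_xt x (mem_head _ _); rewrite /= eqxx hornerZ.
  have := pos_xt y; rewrite inE y_t orbT => /(_ isT) /=.
  case: eqP => [x_eq|_]; first by rewrite x_eq y_t in x_notin.
  by rewrite big_cons P_eq.
exists r => y; rewrite inE => /predU1P[->|y_t] /=.
  by rewrite eqxx -hornerZ; apply: r_pos; rewrite mem_head.
case: eqP => [<-|_]; first by rewrite -hornerZ; apply: r_pos; rewrite mem_head.
by rewrite big_cons P_eq; apply: r_pos; rewrite inE map_f ?orbT.
Qed.

Lemma positive_nodes_rat (R : archiRcfType) (s1 : seq rat) (s2 : seq R) :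
    positive_nodes (map ratr s1 ++ s2) ->
  exists2 s : seq rat, size s = (size s1 + size s2)%N & positive_nodes s.
Proof.
elim: s2 s1 => [|x s2 IHs2] s1.
  by rewrite cats0 => /positive_nodes_ratr pos_s1; exists s1; rewrite ?addn0.
move=> pos_s; have [|q pos_q] := @positive_nodes_perturb R x (map ratr s1 ++ s2).
  by apply: perm_positive_nodes pos_s; rewrite -cat1s perm_catCA.
have [s sz_s pos_s'] := IHs2 (q :: s1) pos_q.
by exists s; rewrite // sz_s /= addSnnS.
Qed.

(** The roots of a Hermite polynomial over the real algebraic numbers, an archimedean real closed
    field, are replaced by rationals one at a time. *)
Lemma exists_positive_nodes (n : nat) :
  exists2 s : seq rat, size s = n & positive_nodes s.
Proof.
have [s s_uniq h_eq] := real_rooted_split (hermite_monic realalg n)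
  (@hermite_no_quadratic_factor realalg n).
have sz_s : size s = n.
  by apply/succn_inj; rewrite -(size_hermite realalg n) h_eq size_prod_XsubC.
rewrite -sz_s; apply: (@positive_nodes_rat realalg [::]).
exact: hermite_positive_nodes h_eq.
Qed.

Lemma common_denominator (T : eqType) (f : T -> rat) (s : seq T) :
  exists2 d : nat, (0 < d)%N &
    exists g : T -> int, forall x, x \in s -> d%:R * f x = (g x)%:~R.
Proof.
elim: s => [|y s [d d_gt0 [g g_eq]]]; first by exists 1%N => //; exists (fun=> 0).
pose e := `|denq (f y)|%N; exists (d * e)%N; first by rewrite muln_gt0 d_gt0 absz_gt0 denq_eq0.
exists (fun x => if x == y then d%:Z * numq (f y) else e%:Z * g x) => x.
have e_eq : e%:R = (denq (f y))%:~R :> rat by rewrite -[denq _]gez0_abs // ltW ?denq_gt0.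
have dn : (denq (f y))%:~R * f y = (numq (f y))%:~R.
  by rewrite numqE mulrC.
rewrite inE natrM; case: eqVneq => [->|_] /=.
  by rewrite -mulrA e_eq dn intrM.
by move=> /g_eq g_x; rewrite intrM -g_x -pmulrn; ring.
Qed.

Lemma gauss_quadrature (D : nat) :
  exists (M d : nat) (s : seq int), [/\ (0 < M)%N, (0 < d)%N &
    forall N, (N <= D)%N -> \sum_(b <- s) b ^+ N = (M * d ^ N * gauss_moment N)%:Z].
Proof.
have [xs sz_xs pos_xs] := exists_positive_nodes D.+1.
have [w w_gt0 w_eq] := positive_nodes_quadrature pos_xs.
have [d d_gt0 [b b_eq]] := common_denominator id xs.
have [M M_gt0 [p p_eq]] := common_denominator w xs.
(* The node [x], scaled to the integer [b x = d x], is repeated [p x = M w(x)] times, which turns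
   weights into multiplicities. *)
exists M, d, (flatten [seq nseq `|p x|%N (b x) | x <- xs]); split=> // N le_N.
rewrite big_flatten big_map /=; apply: (@intr_inj rat).
have -> : (M * d ^ N * gauss_moment N)%:Z%:~R =
    M%:R * d%:R ^+ N * gauss_mean 'X^N :> rat.
  by rewrite gauss_meanXn -natrX -!natrM.
rewrite w_eq ?size_polyXn ?sz_xs // rmorph_sum /= mulr_sumr !big_seq.
apply: eq_bigr => x x_xs; rewrite big_nseq iter_addr_0 hornerXn.
have p_ge0 : 0 <= p x.
  by rewrite -(ler0z rat) -p_eq // mulr_ge0 ?ler0n // ltW ?w_gt0.
rewrite rmorphMn rmorphXn /= -b_eq // -mulr_natr.
have -> : `|p x|%N%:R = M%:R * w x :> rat.
  by rewrite p_eq // -[in RHS](gez0_abs p_ge0).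
rewrite exprMn; ring.
Qed.

(** * Hilbert identities *)

Lemma gauss_moment_odd (n : nat) : odd n -> gauss_moment n = 0%N.
Proof.
have [m] := ubnP n; elim: m n => // m IHm [|[|n]] //= lt_n.
by rewrite negbK gauss_momentSS => /IHm ->; [rewrite muln0 | lia].
Qed.

Lemma gauss_moment_fact (n : nat) : (gauss_moment n.*2 * n`! = n.*2`!)%N.
Proof.
elim: n => // n IHn; rewrite doubleS gauss_momentSS !factS -IHn -!muln2.
by ring.
Qed.

Lemma gauss_moment_gt0 (n : nat) : (0 < gauss_moment n.*2)%N.
Proof. by have := fact_gt0 n.*2; rewrite -gauss_moment_fact muln_gt0 => /andP[]. Qed.

(** This turns the convolution of two families of even moments into the binomial expansion of a
    power of the summed variances. *)
Lemma gauss_moment_bin (n i : nat) : (i <= n)%N ->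
  ('C(n.*2, i.*2) * gauss_moment i.*2 * gauss_moment (n - i).*2 =
   gauss_moment n.*2 * 'C(n, i))%N.
Proof.
move=> le_in; apply/eqP; have fi := fact_gt0 i; have fn := fact_gt0 (n - i).
rewrite -(eqn_pmul2r fi) -(eqn_pmul2r fn); apply/eqP.
transitivity ('C(n.*2, i.*2) * (gauss_moment i.*2 * i`!) *
  (gauss_moment (n - i).*2 * (n - i)`!))%N; first by ring.
rewrite !gauss_moment_fact -mulnA doubleB bin_fact ?leq_double //.
by rewrite -!mulnA bin_fact // gauss_moment_fact.
Qed.

Lemma sum_even_indices (V : nmodType) (f : nat -> V) (n : nat) :
    (forall i, odd i -> f i = 0) ->
  \sum_(i < n.*2.+1) f i = \sum_(i < n.+1) f i.*2.
Proof.
move=> f0; elim: n => [|n IHn]; first by rewrite !big_ord1.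
rewrite doubleS 2!big_ord_recr [RHS]big_ord_recr /= IHn doubleS.
by rewrite (f0 n.*2.+1) ?addr0 //= odd_double.
Qed.

(* The uniform measure on [C] has the moments, up to degree [D], of a centred
   Gaussian with variance proportional to [T]. *)
Definition gauss_family (A : comNzRingType) (D M d : nat) (T : A) (C : seq A) :=
  forall N, (N <= D)%N ->
    \sum_(c <- C) c ^+ N = (M * d ^ N * gauss_moment N)%:R * T ^+ N./2.

Lemma gauss_family0 (A : comNzRingType) (D d : nat) :
  gauss_family D 1 d (0 : A) [:: 0].
Proof.
move=> N _; rewrite big_seq1; case: N => [|N]; first by rewrite !expr0 mulr1.
case: (boolP (odd N.+1)) => [N_odd|N_even].
  by rewrite gauss_moment_odd // muln0 mul0r expr0n.
by case: N N_even => // N _; rewrite !expr0n mulr0.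
Qed.

Lemma gauss_family_map (A B : comNzRingType) (f : {rmorphism A -> B})
    (D M d : nat) (T : A) (C : seq A) :
  gauss_family D M d T C -> gauss_family D M d (f T) (map f C).
Proof.
move=> CT N /CT eqN; rewrite big_map -rmorphXn -(rmorph_nat f) -rmorphM -eqN.
by rewrite rmorph_sum; apply: eq_bigr => c _; rewrite rmorphXn.
Qed.

(* A sum of independent centred Gaussians is Gaussian and the variances add. *)
Lemma gauss_family_add (A : comNzRingType) (D M1 M2 d : nat) (T y : A)
    (s : seq int) (C : seq A) :
    (forall N, (N <= D)%N ->
       \sum_(b <- s) b ^+ N = (M1 * d ^ N * gauss_moment N)%:Z) ->
    gauss_family D M2 d T C ->
  gauss_family D (M1 * M2) d (y ^+ 2 + T) [seq b%:~R * y + c | b <- s, c <- C].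
Proof.
move=> s_mom C_mom N le_ND; rewrite big_allpairs_dep /=.
pose f i := (('C(N, i) * (M1 * d ^ i * gauss_moment i) *
  (M2 * d ^ (N - i) * gauss_moment (N - i)))%:R * (y ^+ i * T ^+ (N - i)./2) : A).
transitivity (\sum_(i < N.+1) f i).
  under eq_bigr => b _ do under eq_bigr => c _ do rewrite addrC exprDn.
  under eq_bigr => b _ do rewrite exchange_big /=.
  rewrite exchange_big /=; apply: eq_bigr => i _; have lt_i := ltn_ord i.
  rewrite /f !natrM.
  transitivity ('C(N, i)%:R * ((\sum_(b <- s) b ^+ i)%:~R * y ^+ i *
     \sum_(c <- C) c ^+ (N - i))).
    rewrite rmorph_sum !mulr_suml mulr_sumr; apply: eq_bigr => b _.
    rewrite !mulr_sumr; apply: eq_bigr => c _.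
    by rewrite rmorphXn -mulr_natr /= exprMn; ring.
  rewrite s_mom ?C_mom ?(leq_trans (leq_subr _ _)) //; last by lia.
  by rewrite -pmulrn !natrM; ring.
(* For odd [N], one of [i] and [N - i] is odd, so every term vanishes. *)
case: (boolP (odd N)) => [N_odd|N_even].
  rewrite gauss_moment_odd // muln0 mul0r big1 // => i _; rewrite /f.
  case: (boolP (odd i)) => [i_odd|i_even].
    by rewrite (gauss_moment_odd i_odd) !(muln0, mul0n) mul0r.
  rewrite (@gauss_moment_odd (N - i)) ?muln0 ?mul0r // oddB -1?ltnS //.
  by rewrite N_odd (negPf i_even).
have [n N_eq] : exists n, N = n.*2.
  by exists N./2; rewrite -[LHS]odd_double_half (negPf N_even).
rewrite N_eq doubleK sum_even_indices => [|i i_odd]; last first.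
  by rewrite /f (gauss_moment_odd i_odd) !(muln0, mul0n) mul0r.
rewrite addrC exprDn mulr_sumr; apply: eq_bigr => i _.
have le_in : (i <= n)%N by rewrite -ltnS.
rewrite /f N_eq -doubleB doubleK -mulr_natr -exprM mul2n.
set k := (_ * _ * _)%N.
have -> : k = (M1 * M2 * (d ^ i.*2 * d ^ (n - i).*2) *
   ('C(n.*2, i.*2) * gauss_moment i.*2 * gauss_moment (n - i).*2))%N.
  by rewrite /k; ring.
by rewrite gauss_moment_bin // -expnD -doubleD subnKC // !natrM; ring.
Qed.

Lemma coef_linear_exp (A : comNzRingType) (a e : A) (N i : nat) :
  ((a%:P * 'X + e%:P) ^+ N)`_i = 'C(N, i)%:R * (a ^+ i * e ^+ (N - i)).
Proof.
rewrite addrC exprDn coef_sum.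
have term (j : 'I_N.+1) : ((e%:P ^+ (N - j) * (a%:P * 'X) ^+ j) *+ 'C(N, j))`_i =
    if i == j :> nat then 'C(N, i)%:R * (a ^+ i * e ^+ (N - i)) else 0.
  rewrite exprMn -!polyC_exp coefMn !coefCM coefXn.
  case: eqP => [->|_]; last by rewrite !mulr0 mul0rn.
  by rewrite mulr1 -mulr_natl; ring.
under eq_bigr => j _ do rewrite term.
rewrite -big_mkcond /=; have [le_iN|lt_Ni] := leqP i N.
  rewrite (big_pred1 (inord i)) // => j; rewrite /= -(inj_eq val_inj) /= inordK // eq_sym.
rewrite bin_small // mul0r big1 // => j /eqP ij; have := ltn_ord j; lia.
Qed.

(* Coefficient of [h ^ 2l] in [(U + h (2x + h)) ^ n], the expansion at [x + h]
   of [((x + h)^2 + T) ^ n] where [U = x^2 + T]. *)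
Lemma coef_shifted_power (A : comNzRingType) (U x : A) (n l : nat) :
  ((U%:P + 'X * ('X + (2 * x)%:P)) ^+ n)`_l.*2 =
  \sum_(j < n.+1 | (l <= j <= l.*2)%N)
    ('C(n, j) * 'C(j, l.*2 - j) * 4 ^ (j - l))%:R * (x ^+ (j - l).*2 * U ^+ (n - j)).
Proof.
rewrite exprDn coef_sum [RHS]big_mkcond; apply: eq_bigr => j _.
rewrite coefMn -polyC_exp coefCM exprMn mulrC ['X^j * _]mulrC coefMXn.
have := @coef_linear_exp A 1 (2 * x) j (l.*2 - j); rewrite mul1r => ->.
case: (ltnP l.*2 j) => [lt_lj|le_jl]; first by rewrite andbF mul0r mul0rn.
rewrite andbT; case: (leqP l j) => [le_lj|lt_jl]; last first.
  by rewrite bin_small ?mul0r ?mul0r ?mul0rn //; lia.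
have -> : (j - (l.*2 - j) = (j - l).*2)%N by lia.
rewrite expr1n mul1r exprMn -mulr_natr !natrM natrX.
have -> : 2 ^+ (j - l).*2 = 4 ^+ (j - l) :> A.
  by rewrite -mul2n exprM; congr (_ ^+ _); rewrite expr2 -natrM.
ring.
Qed.

(** * Sums of boundedly many [k]-th powers *)

Definition pow_sum (k g n : nat) : Prop :=
  exists s : seq nat, (size s <= g)%N /\ (\sum_(x <- s) x ^ k)%N = n.

Section PowSum.
Local Open Scope nat_scope.
Variable k : nat.

Lemma pow_sum0 (g : nat) : pow_sum k g 0.
Proof. by exists [::]; rewrite big_nil. Qed.

Lemma pow_sum_pow (x : nat) : pow_sum k 1 (x ^ k).
Proof. by exists [:: x]; rewrite big_seq1. Qed.

Lemma pow_sum_leq (g h n : nat) : g <= h -> pow_sum k g n -> pow_sum k h n.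
Proof. by move=> le_gh [s [le_s s_n]]; exists s; rewrite (leq_trans le_s). Qed.

Lemma pow_sumD (g h m n : nat) :
  pow_sum k g m -> pow_sum k h n -> pow_sum k (g + h) (m + n).
Proof.
move=> [s [le_s <-]] [t [le_t <-]]; exists (s ++ t).
by rewrite size_cat leq_add // big_cat.
Qed.

Lemma pow_sum_sum (I : eqType) (r : seq I) (g n : I -> nat) :
    (forall i, i \in r -> pow_sum k (g i) (n i)) ->
  pow_sum k (\sum_(i <- r) g i) (\sum_(i <- r) n i).
Proof.
elim: r => [_|i r IHr gn]; first by rewrite !big_nil; apply: pow_sum0.
rewrite !big_cons; apply: pow_sumD; first exact/gn/mem_head.
by apply: IHr => j r_j; apply: gn; rewrite inE r_j orbT.
Qed.

Lemma pow_sumM (c g n : nat) : pow_sum k g n -> pow_sum k (c * g) (c * n).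
Proof.
move=> gn; have := @pow_sum_sum _ (nseq c tt) (fun=> g) (fun=> n) (fun _ _ => gn).
by rewrite !big_nseq !iter_addn_0 ![_ * c]mulnC.
Qed.

Lemma pow_sum_self (n : nat) : pow_sum k n n.
Proof. by have := pow_sumM n (pow_sum_pow 1); rewrite exp1n muln1. Qed.

End PowSum.

(** Write [T = U - x ^ 2] as four squares and [n = k + l]. Gaussian families make a multiple of
    [((x + X) ^ 2 + T) ^ n] a sum of powers [(b (x + X) + c) ^ 2n]. Comparing coefficients of
    [X ^ 2l] leaves [2k]-th powers of [b x + c], whose number depends neither on [x] nor on [U]. *)
Lemma hilbert_identity (k l : nat) :
  exists (m g : nat), (0 < m)%N /\ forall x U : nat, (x ^ 2 <= U)%N ->
    pow_sum k.*2 g (\sum_(j < (k + l).+1 | l <= j <= l.*2)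
      (m * ('C(k + l, j) * 'C(j, l.*2 - j) * 4 ^ (j - l)) *
       (x ^ (j - l).*2 * U ^ (k + l - j))))%N.
Proof.
pose n := (k + l)%N.
have [M [d [s [M_gt0 d_gt0 s_mom]]]] := gauss_quadrature n.*2.
pose c1 := 'C(n.*2, l.*2).
(* One factor [M] for the linear form [x + X] and one for each of the four squares. *)
exists (M * (M * (M * (M * (M * 1)))) * d ^ n.*2 * gauss_moment n.*2)%N.
(* For each [b] there are [size s ^ 4] values of [c], and the power of [b x + c] is repeated as
   often as its coefficient says. *)
exists (\sum_(b <- s) size s ^ 4 * (c1 * `|b| ^ l.*2))%N.
split; first by rewrite !muln_gt0 expn_gt0 M_gt0 d_gt0 gauss_moment_gt0.
move=> x U le_xU; set m := (M * _ * _ * _)%N.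
have [y1 [y2 [y3 [y4 T_eq]]]] := lagrange_four_squares (U - x ^ 2).
have [C sz_C C_mom] : exists2 C : seq int, size C = (size s ^ 4)%N &
    gauss_family n.*2 (M * (M * (M * (M * 1)))) d (U - x ^ 2)%N%:Z C.
  have := gauss_family_add y1 s_mom (gauss_family_add y2 s_mom
    (gauss_family_add y3 s_mom (gauss_family_add y4 s_mom
      (@gauss_family0 int n.*2 d)))).
  rewrite addr0 !addrA -T_eq => C_mom; eexists; last exact: C_mom.
  by rewrite !size_allpairs /=; ring.
have := gauss_family_add (x%:Z%:P + 'X) s_mom (gauss_family_map polyC C_mom).
move=> /(_ _ (leqnn _)); rewrite big_allpairs_dep /=.
under eq_bigr => b _ do rewrite big_map.
have -> : (x%:Z%:P + 'X) ^+ 2 + (U - x ^ 2)%N%:Z%:P =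
    U%:Z%:P + 'X * ('X + (2 * x%:Z)%:P) :> {poly int}.
  have -> : (U - x ^ 2)%N%:Z = U%:Z - x%:Z * x%:Z by rewrite -subzn // -mulnn PoszM.
  by rewrite polyCB !polyCM; ring.
move=> /(congr1 (fun p : {poly int} => p`_l.*2)).
rewrite doubleK -/m mulr_natl coefMn coef_shifted_power coef_sum -mulr_natl.
have term (b c : int) : ((b%:~R * (x%:Z%:P + 'X) + c%:P) ^+ n.*2)`_l.*2 =
    (c1 * `|b| ^ l.*2 * `|(b * x%:Z + c)%R| ^ k.*2)%N%:Z.
  have -> : b%:~R * (x%:Z%:P + 'X) + c%:P = b%:P * 'X + (b * x%:Z + c)%:P :> {poly int}.
    by rewrite -[b%:~R](rmorph_int polyC) intz polyCD polyCM; ring.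
  rewrite coef_linear_exp -doubleB addnK -!mul2n -[RHS]natz !natrM !natrX !natz.
  have even_abs (z : int) j : `|z|%N%:Z ^+ (2 * j) = z ^+ (2 * j).
    by rewrite !exprM abszE real_normK // num_real.
  by rewrite !even_abs ?natz mulrA /c1 -!mul2n.
set lhs := (X in X = _ -> _) => eq_int.
have lhs_eq : lhs = \sum_(b <- s) \sum_(c <- C)
    (c1 * `|b| ^ l.*2 * `|(b * x%:Z + c)%R| ^ k.*2)%N%:Z.
  by apply: eq_bigr => b _; rewrite coef_sum; apply: eq_bigr => c _; apply: term.
have <- : (\sum_(b <- s) \sum_(c <- C)
    c1 * `|b| ^ l.*2 * `|(b * x%:Z + c)%R| ^ k.*2)%N =
  (\sum_(j < n.+1 | l <= j <= l.*2) (m * ('C(n, j) * 'C(j, l.*2 - j) * 4 ^ (j - l)) *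
       (x ^ (j - l).*2 * U ^ (n - j))))%N.
  apply/eqP; rewrite -eqz_nat; apply/eqP.
  rewrite -[LHS]natz -[RHS]natz !natr_sum.
  under eq_bigr => b _ do rewrite natr_sum.
  under eq_bigr => b _ do under eq_bigr => c _ do rewrite natz.
  rewrite -lhs_eq eq_int mulr_sumr; apply: eq_bigr => j _.
  by rewrite !natrM !natrX !natz; ring.
apply: pow_sum_sum => b _; rewrite -sz_C -sum1_size big_distrl /=.
apply: pow_sum_sum => c _; rewrite mul1n.
by have := pow_sumM (c1 * `|b| ^ l.*2) (pow_sum_pow k.*2 `|(b * x%:Z + c)%R|); rewrite muln1.
Qed.

Lemma pow_sum_double (k g n : nat) : pow_sum k.*2 g n -> pow_sum k g n.
Proof.
move=> [s [le_s <-]]; exists [seq (x ^ 2)%N | x <- s].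
rewrite size_map big_map; split=> //; apply: eq_bigr => x _.
by rewrite -expnM mul2n.
Qed.

(** * The Hilbert-Waring theorem *)

Section Waring.
Local Open Scope nat_scope.

Lemma leq_expl (e a b : nat) : a <= b -> a ^ e <= b ^ e.
Proof. by case: e => // e; rewrite leq_exp2r. Qed.

Definition waring_bounded (k : nat) : Prop := exists g, forall n, pow_sum k g n.

Lemma waring_multiples (k g q : nat) : 0 < q ->
  (forall t, pow_sum k g (q * t)) -> waring_bounded k.
Proof.
move=> q_gt0 gq; exists (g + q) => n; rewrite (divn_eq n q) mulnC.
apply: pow_sumD => //; apply: pow_sum_leq (pow_sum_self k _).
by rewrite ltnW // ltn_mod.
Qed.

(** For [l = 0] and [x = 0] the identity writes [m U ^ k] as a bounded sum of [2k]-th powers. So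
    every multiple of [m] is such a sum, and ones make up the remainder. *)
Lemma waring_bounded_double (k : nat) : waring_bounded k -> waring_bounded k.*2.
Proof.
move=> [g Wk]; have [m [h [m_gt0 hU]]] := hilbert_identity k 0.
have powU (U : nat) : pow_sum k.*2 h (m * U ^ k).
  have := hU 0 U (leq0n _); rewrite (big_pred1 ord0) => [|j].
    by rewrite /= !addn0 !subn0 !bin0 !expn0 !muln1 !mul1n.
  by rewrite /= -(inj_eq val_inj) /= leqn0.
apply: (@waring_multiples _ (g * h) _ m_gt0) => t; have [s [le_s <-]] := Wk t.
rewrite big_distrr /=.
apply: pow_sum_leq (pow_sum_sum (g := fun=> h) (fun x _ => powU x)).
by rewrite big_const_seq count_predT iter_addn_0 mulnC leq_mul2r le_s orbT.
Qed.

(** Write [C] as a sum of [2l]-th powers [x ^ 2l] and add the identities for these [x]. The terms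
    [j = 2l] add up to [A C U ^ (k - l)]; those with [j < 2l] are multiples of [U ^ (k - l + 1)] and
    go into [E]. *)
Lemma middle_digit (k l : nat) : 0 < l < k -> waring_bounded l.*2 ->
  exists A g K, 0 < A /\ forall U C, C < U -> exists E,
    let v := E * U ^ (k - l).+1 + A * C * U ^ (k - l) in
    pow_sum k g v /\ v <= K * U ^ k.
Proof.
move=> /andP[l_gt0 lt_lk] [r W2l]; have [m [g [m_gt0 hU]]] := hilbert_identity k l.
pose B j := m * ('C(k + l, j) * 'C(j, l.*2 - j) * 4 ^ (j - l)).
pose F U x := \sum_(j < (k + l).+1 | l <= j <= l.*2)
  B j * (x ^ (j - l).*2 * U ^ (k + l - j)).
pose e U x := \sum_(j < (k + l).+1 | (l <= j <= l.*2) && (j != l.*2 :> nat))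
  B j * (x ^ (j - l).*2 * U ^ (l.*2.-1 - j)).
pose K := \sum_(j < (k + l).+1 | l <= j <= l.*2) B j.
have hF x U : x ^ 2 <= U -> pow_sum k.*2 g (F U x) by apply: hU.
have B_gt0 : 0 < B l.*2.
  by rewrite /B !muln_gt0 m_gt0 expn_gt0 !bin_gt0 subnn !andbT; lia.
clearbody B; exists (B l.*2), (r * g), (r * K); split=> //.
move=> U C lt_CU; have [s [le_s C_eq]] := W2l C.
(* Since [x ^ 2l <= C < U] and [l > 0], the identity applies to every [x] in [s]. *)
have s_sqr x : x \in s -> x ^ 2 <= U.
  move=> x_s; have le_xC : x ^ l.*2 <= C by rewrite -C_eq (big_rem x) //= leq_addr.
  case: (posnP x) => [->|x_gt0] //.
  apply: leq_trans (ltnW lt_CU); apply: leq_trans le_xC.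
  by rewrite leq_pexp2l //; lia.
have F_eq x : F U x = e U x * U ^ (k - l).+1 + B l.*2 * x ^ l.*2 * U ^ (k - l).
  have lt_l2 : l.*2 < (k + l).+1 by lia.
  rewrite /F (bigD1 (Ordinal lt_l2)) /=; last by lia.
  rewrite addnC; congr (_ + _); last first.
    have -> : l.*2 - l = l by lia.
    have -> : k + l - l.*2 = k - l by lia.
    by rewrite mulnA.
  rewrite big_distrl /=; apply: eq_bigr => j /andP[/andP[le_lj le_jl] ne_j].
  have ne_j' : j != l.*2 :> nat by [].
  rewrite -!mulnA -expnD; congr (_ * (_ * _ ^ _)); lia.
exists (\sum_(x <- s) e U x) => v.
have v_eq : v = \sum_(x <- s) F U x.
  under eq_bigr => x _ do rewrite F_eq.
  by rewrite big_split /= -big_distrl /= -big_distrl -big_distrr /= C_eq.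
rewrite v_eq; split.
  apply: pow_sum_leq (pow_sum_sum (g := fun=> g) _).
    by rewrite big_const_seq count_predT iter_addn_0 mulnC leq_mul2r le_s orbT.
  by move=> x x_s; apply/pow_sum_double/hF/s_sqr.
have F_le x : x \in s -> F U x <= K * U ^ k.
  move=> /s_sqr le_xU; rewrite /F /K big_distrl; apply: leq_sum => j /andP[le_lj le_jl].
  rewrite leq_mul2l; apply/orP; right.
  have -> : U ^ k = U ^ (j - l) * U ^ (k + l - j) by rewrite -expnD; congr (_ ^ _); lia.
  by rewrite leq_mul2r -mul2n expnM leq_expl ?orbT.
rewrite big_seq; apply: (@leq_trans (\sum_(x <- s | x \in s) K * U ^ k)).
  exact: leq_sum.
by rewrite -big_seq big_const_seq count_predT iter_addn_0 mulnC -mulnA leq_mul2r le_s orbT.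
Qed.


(** A single [A] serves all [l]: it is the product of the individual constants, each representation
    being repeated by the complementary factor. *)
Lemma middle_digits (k : nat) : (forall l, 0 < l < k -> waring_bounded l.*2) ->
  exists A g K, 0 < A /\ forall l U C, 0 < l < k -> C < U -> exists E,
    let v := E * U ^ (k - l).+1 + A * C * U ^ (k - l) in
    pow_sum k g v /\ v <= K * U ^ k.
Proof.
move=> W; suff: forall b, b <= k -> exists A g K, 0 < A /\
    forall l U C, 0 < l < b -> C < U -> exists E,
    let v := E * U ^ (k - l).+1 + A * C * U ^ (k - l) in
    pow_sum k g v /\ v <= K * U ^ k by apply.
elim=> [|b IHb] lt_bk; first by exists 1, 0, 0; split=> // l U C; lia.
have [A [g [K [A_gt0 digit]]]] := IHb (ltnW lt_bk).
have [b0|b_gt0] := posnP b; first by exists A, g, K; split=> // l U C; lia.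
have b_bd : 0 < b < k by rewrite b_gt0.
have [A' [g' [K' [A'_gt0 digit']]]] := middle_digit b_bd (W b b_bd).
exists (A * A'), (A' * g + A * g'), (A' * K + A * K').
split; first by rewrite muln_gt0 A_gt0.
move=> l U C /andP[l_gt0]; rewrite ltnS leq_eqVlt => /predU1P[-> | lt_lb] lt_CU.
  have [E /= [gv v_le]] := digit' U C lt_CU.
  exists (A * E) => /=; set v := _ + _ * U ^ _.
  have -> : v = A * (E * U ^ (k - b).+1 + A' * C * U ^ (k - b)).
    by rewrite /v; ring.
  split; first by apply: pow_sum_leq (pow_sumM A gv); rewrite leq_addl.
  apply: (@leq_trans (A * (K' * U ^ k))); first by rewrite leq_mul2l v_le orbT.
  by rewrite mulnDl -!mulnA leq_addl.
have [|E /= [gv v_le]] := digit l U C _ lt_CU; first by rewrite l_gt0.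
exists (A' * E) => /=; set v := _ + _ * U ^ _.
have -> : v = A' * (E * U ^ (k - l).+1 + A * C * U ^ (k - l)).
  by rewrite /v; ring.
split; first by apply: pow_sum_leq (pow_sumM A' gv); rewrite leq_addr.
apply: (@leq_trans (A' * (K * U ^ k))); first by rewrite leq_mul2l v_le orbT.
by rewrite mulnDl -!mulnA leq_addr.
Qed.

Lemma coprime_mul_mod (U A t : nat) : 0 < U -> 0 < A -> coprime A U ->
  exists2 c, c < U & A * c = t %[mod U].
Proof.
move=> U_gt0 A_gt0 co_AU; have /coprimeP[//|[u v] /= uv_eq] := co_AU.
exists (u * t %% U); first by rewrite ltn_mod.
have uA : u * A = 1 + v * U by lia.
by rewrite modnMmr mulnA [A * u]mulnC uA mulnDl mul1n mulnAC addnC modnMDl.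
Qed.

(** The base-[U] digits at positions 1 to [p] are corrected from the lowest upwards, as a correction
    at one position disturbs only higher ones. Position 0 would correspond to [l = k], so only
    multiples of [U] are targeted. *)
Lemma residues_mod_pow (k p A g K : nat) : p < k -> 0 < A ->
    (forall l U C, 0 < l < k -> C < U -> exists E,
      let v := E * U ^ (k - l).+1 + A * C * U ^ (k - l) in
      pow_sum k g v /\ v <= K * U ^ k) ->
  forall U N, 0 < U -> coprime A U -> exists v,
    [/\ pow_sum k (p * g) v, v <= p * K * U ^ k & v = U * N %[mod U ^ p.+1]].
Proof.
move=> lt_pk A_gt0 digit U N U_gt0 co_AU; elim: p lt_pk => [|p IHp] lt_pk.
  by exists 0; split=> //; [apply: pow_sum0 | rewrite expn1 mod0n modnMr].
have [v [gv v_le v_mod]] := IHp (ltnW lt_pk).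
(* [t] is the missing digit modulo [U]; when [v] exceeds [U N], subtracting [t] is replaced by
   adding [t (U - 1)]. *)
have [t [z tz_eq]] : exists t z, v + t * U ^ p.+1 = U * N + z * U ^ p.+2.
  case: (leqP v (U * N)) => [le_v|/ltnW le_v].
    move/esym/eqP: v_mod; rewrite eqn_mod_dvd // => /dvdnP[t t_eq].
    by exists t, 0; rewrite -t_eq subnKC // mul0n addn0.
  move/eqP: v_mod; rewrite eqn_mod_dvd // => /dvdnP[t t_eq].
  exists (t * U.-1), t; rewrite -(subnKC le_v) t_eq -addnA; congr (_ + _).
  by rewrite -mulnA -mulnDr -mulSn prednK // -expnS.
have [C lt_CU C_mod] := coprime_mul_mod t U_gt0 A_gt0 co_AU.
have [|E /=] := digit (k - p.+1) U C _ lt_CU; first by lia.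
rewrite subKn; last exact: ltnW.
set w := E * _ + _ => -[gw w_le]; exists (v + w); split.
- by rewrite mulSn addnC; apply: pow_sumD.
- by rewrite !mulSn !mulnDl addnC leq_add.
have -> : v + w = v + A * C * U ^ p.+1 %[mod U ^ p.+2].
  by rewrite /w addnA [v + _]addnC -addnA modnMDl.
rewrite -modnDmr.
have -> : (A * C * U ^ p.+1) %% U ^ p.+2 = (t * U ^ p.+1) %% U ^ p.+2.
  by rewrite [U ^ p.+2]expnS -!muln_modl C_mod.
by rewrite modnDmr tz_eq addnC modnMDl.
Qed.

(** The lower bound makes the [v] congruent to [U N] modulo [U ^ k] at most [U N]; the upper bound
    leaves at most [Q] copies of [U ^ k] to add. *)
Lemma multiples_in_window (k A g K Q : nat) : 0 < k -> 0 < A ->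
    (forall l U C, 0 < l < k -> C < U -> exists E,
      let v := E * U ^ (k - l).+1 + A * C * U ^ (k - l) in
      pow_sum k g v /\ v <= K * U ^ k) ->
  forall U N, 0 < U -> coprime A U -> k * K * U ^ k <= U * N <= Q * U ^ k ->
    pow_sum k (k * g + Q) (U * N).
Proof.
move=> k_gt0 A_gt0 digit U N U_gt0 co_AU /andP[le_UN UN_le].
have lt_k : k.-1 < k by rewrite prednK.
have [v [gv v_le v_mod]] := residues_mod_pow lt_k A_gt0 digit N U_gt0 co_AU.
have le_v : v <= U * N.
  by apply: leq_trans le_UN; apply: leq_trans v_le _; rewrite !leq_mul2r leq_pred !orbT.
move/esym/eqP: v_mod; rewrite eqn_mod_dvd // prednK // => /dvdnP[t t_eq].
have le_tQ : t <= Q.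
  rewrite -(@leq_pmul2r (U ^ k)) ?expn_gt0 ?U_gt0 // -t_eq.
  by apply: leq_trans UN_le; rewrite leq_subr.
rewrite -(subnKC le_v) t_eq; apply: pow_sumD.
  by apply: pow_sum_leq gv; rewrite leq_mul2r leq_pred orbT.
by apply: pow_sum_leq (pow_sumM t (pow_sum_pow k U)); rewrite muln1.
Qed.

(* Every large [n] splits as [U a + (U + A) b] with both terms in the windows
   of [multiples_in_window], where [U = A u + 1] is of order [n ^ (1 / k)]. *)
Lemma waring_step (k : nat) : 1 < k ->
  (forall l, 0 < l < k -> waring_bounded l.*2) -> waring_bounded k.
Proof.
move=> k_gt1 /middle_digits[A [g [K [A_gt0 digit]]]].
have k_gt0 := ltnW k_gt1.
(* [Q0 U ^ k] has room for the lower ends of both windows and for [U' c <= 2 U ^ k]. The factor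
   [2 ^ k] in [Q] accounts for [U' <= 2 U], and [n0] makes [u = 1] admissible. *)
pose K1 := k * K; pose Q0 := K1 * 2 ^ k + K1 + 3; pose Q := Q0 * 2 ^ k.
pose G := k * g + Q; pose n0 := Q0 * A.+1 ^ k.
exists (G + G + n0) => n.
have [lt_n|le_n] := ltnP n n0.
  by apply: pow_sum_leq (pow_sum_self k n); rewrite (leq_trans (ltnW lt_n)) ?leq_addl.
apply: (@pow_sum_leq _ (G + G)); first by rewrite leq_addr.
pose P u := (0 < u) && (Q0 * (A * u).+1 ^ k <= n).
have Q0_gt0 : 0 < Q0 by rewrite /Q0 addn3.
have exP : exists u, P u by exists 1; rewrite /P muln1.
have ubP u : P u -> u <= n.
  move=> /andP[u_gt0 le_un]; apply: leq_trans le_un.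
  apply: leq_trans (leq_pmull _ Q0_gt0); apply: leq_trans (_ : (A * u).+1 <= _).
    by rewrite (leq_trans (leq_pmull u A_gt0)).
  by rewrite -{1}[(A * u).+1]expn1 leq_pexp2l.
case: (ex_maxnP exP ubP) => u /andP[u_gt0 le_Un] u_max.
pose U := (A * u).+1; pose U' := U + A.
have U'_eq : U' = (A * u.+1).+1 by rewrite /U' /U mulnS addnC addnS.
have lt_nU' : n < Q0 * U' ^ k.
  rewrite ltnNge; apply/negP => le_n'.
  by have := u_max u.+1; rewrite /P -U'_eq le_n' ltnn => /(_ isT).
have le_U'2U : U' <= 2 * U.
  by rewrite /U' mul2n -addnn leq_add2l ltnW // /U ltnS leq_pmulr.
have co_AU : coprime A U by rewrite /U -addn1 mulnC /coprime gcdnMDl gcdn1.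
have co_AU' : coprime A U' by rewrite /coprime gcdnDr.
have co_U'U : coprime U' U by rewrite coprime_sym /coprime gcdnDl gcdnC.
have U_gt0 : 0 < U by []; have U'_gt0 : 0 < U' by [].
(* [c] is chosen so that [U] divides [n - V], while [V] stays a multiple of [U']. *)
have [c lt_cU c_mod] := coprime_mul_mod (n - K1 * U' ^ k) U_gt0 U'_gt0 co_U'U.
have U'k_le : U' ^ k <= 2 ^ k * U ^ k by rewrite -expnMn leq_expl.
have U2_le : U ^ 2 <= U ^ k by rewrite leq_pexp2l.
have U'c_le : U' * c <= 2 * U ^ k.
  apply: (@leq_trans (2 * U ^ 2)); last by rewrite leq_mul2l.
  by rewrite -mulnn mulnA leq_mul // ltnW.
have lt_nQ : n <= Q * U ^ k.
  by apply: leq_trans (ltnW lt_nU') _; rewrite /Q -mulnA leq_mul2l U'k_le orbT.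
rewrite -/U in le_Un; clearbody U'; clearbody U.
set V := K1 * U' ^ k + U' * c.
have K1U'_le : K1 * U' ^ k <= K1 * 2 ^ k * U ^ k by rewrite -mulnA leq_mul2l U'k_le orbT.
have V_le : V + K1 * U ^ k <= n.
  apply: leq_trans le_Un; rewrite /Q0 /V !mulnDl; move: K1U'_le U'c_le.
  move: (K1 * U' ^ k) (U' * c) (K1 * 2 ^ k * U ^ k) (K1 * U ^ k) (U ^ k).
  by clear=> *; lia.
have le_Vn : V <= n by apply: leq_trans V_le; rewrite leq_addr.
have /dvdnP[N N_eq] : U %| n - V.
  rewrite -eqn_mod_dvd // /V -modnDmr c_mod modnDmr subnKC //.
  by apply: leq_trans le_Vn; rewrite leq_addr.
have V_eq : V = U' * (K1 * U' ^ k.-1 + c).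
  by rewrite /V mulnDr mulnCA -expnS prednK.
rewrite -(subnK le_Vn) N_eq; apply: pow_sumD.
  rewrite [N * U]mulnC; apply: (multiples_in_window k_gt0 A_gt0 digit U_gt0 co_AU).
  rewrite [U * N]mulnC -N_eq; apply/andP; split; last first.
    by apply: leq_trans lt_nQ; rewrite leq_subr.
  by rewrite leq_subRL // addnC.
rewrite V_eq; apply: (multiples_in_window k_gt0 A_gt0 digit U'_gt0 co_AU').
rewrite -V_eq leq_addr /=; apply: leq_trans le_Vn _; apply: leq_trans (ltnW lt_nU') _.
by rewrite leq_mul2r leq_pmulr ?expn_gt0 ?orbT.
Qed.

(** Strong induction: the exponents [2l] with [l < k] follow from the exponents [l] by doubling. *)
Theorem hilbert_waring (k : nat) : 0 < k -> waring_bounded k.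
Proof.
elim/ltn_ind: k => k IHk k_gt0; have [k_le1|k_gt1] := leqP k 1.
  have -> : k = 1 by lia.
  by exists 1 => n; have := pow_sum_pow 1 n; rewrite expn1.
by apply: waring_step => // l /andP[l_gt0 lt_lk]; apply/waring_bounded_double/IHk.
Qed.

End Waring.

(** * Forms with prescribed exceptions *)

Lemma waringP (m : nat) : (0 < m)%N -> sum_of_powers m (waring m).
Proof.
move=> m_gt0; have [g Wg] := hilbert_waring m_gt0.
have exW : exists g, `[< sum_of_powers m g >] by exists g; apply/asboolP => N _; apply: Wg.
case: (ex_minnP exW) => h /asboolP Wh h_min.
suff [] : [set g : nat | sum_of_powers m g /\
    forall g' : nat, sum_of_powers m g' -> (g <= g')%N]%classic (waring m) by [].
by apply: xgetPex; exists h; split=> // g' /asboolP; apply: h_min.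
Qed.

Lemma waring_gt0 (m : nat) : (0 < m)%N -> (0 < waring m)%N.
Proof.
move=> /waringP/(_ 1%N isT)[s [le_s]]; rewrite lt0n; apply: contra_eq_neq => w0.
by move: le_s; rewrite w0 leqn0 => /nilP ->; rewrite big_nil.
Qed.

(** * Diagonal forms with coupling terms *)

Section Form.
Variables (m n D : nat) (P : pred 'I_n) (c : 'I_n -> nat).

(* The mixed terms, of total degree [m > 2], are at least [D] at every integer
   point with two nonzero coordinates in [P]. *)
Definition coupled_form : {mpoly int[n]} :=
  \sum_i 'X_i ^+ m *+ c i +
  \sum_i \sum_(j | [&& P i, P j & i != j]) ('X_i ^+ 2 * 'X_j ^+ (m - 2)) *+ D.

(** Stated over any ring so that the same bounds serve integer values and real positivity. *)
Definition coupled_value (K : comNzRingType) (x : 'I_n -> K) : K :=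
  \sum_i x i ^+ m *+ c i +
  \sum_i \sum_(j | [&& P i, P j & i != j]) (x i ^+ 2 * x j ^+ (m - 2)) *+ D.

Lemma coupled_form_meval (x : 'I_n -> int) : coupled_form.@[x] = coupled_value x.
Proof.
rewrite mevalD !raddf_sum; congr (_ + _); apply: eq_bigr => i _.
  by rewrite /= mevalMn rmorphXn /= mevalXU.
rewrite raddf_sum; apply: eq_bigr => j _.
by rewrite /= mevalMn mevalM !rmorphXn /= !mevalXU.
Qed.

Lemma coupled_form_map_meval (R : comNzRingType) (x : 'I_n -> R) :
  (map_mpoly (intr : int -> R) coupled_form).@[x] = coupled_value x.
Proof.
have X_eq i : (map_mpoly (intr : int -> R) 'X_i).@[x] = x i.
  by rewrite map_mpolyX mevalXU.
have sum_eq (I : finType) (p : pred I) (F : I -> {mpoly int[n]}) :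
    (map_mpoly (intr : int -> R) (\sum_(i | p i) F i)).@[x] =
    \sum_(i | p i) (map_mpoly (intr : int -> R) (F i)).@[x].
  by rewrite (raddf_sum (map_mpoly (intr : int -> R))) (raddf_sum (meval x)).
rewrite rmorphD mevalD !sum_eq; congr (_ + _); apply: eq_bigr => i _.
  by rewrite rmorphMn mevalMn !rmorphXn /= X_eq.
rewrite sum_eq; apply: eq_bigr => j _.
by rewrite rmorphMn mevalMn rmorphM mevalM !rmorphXn /= !X_eq.
Qed.

Lemma coupled_form_homog : (2 <= m)%N -> coupled_form \is m.-homog.
Proof.
move=> m_ge2; have X_homog i e : ('X_i ^+ e : {mpoly int[n]}) \is e.-homog.
  by rewrite mpolyXn dhomogX /= mdegMn mdeg1 mul1n.
apply: rpredD; apply: rpred_sum => i _; first by rewrite rpredMn.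
apply: rpred_sum => j _; rewrite rpredMn //.
by rewrite -[X in _ \is X.-homog](subnKC m_ge2) dhomogM.
Qed.

(** Here [m > 2] enters: [x j ^ (m - 2)] must vanish together with [x j]. *)
Lemma coupled_value_diag (K : realDomainType) (x : 'I_n -> K) : (2 < m)%N ->
    (forall i j, P i -> P j -> i != j -> x i = 0 \/ x j = 0) ->
  coupled_value x = \sum_i x i ^+ m *+ c i.
Proof.
move=> m_gt2 x0; rewrite /coupled_value [X in _ + X]big1 ?addr0 // => i _.
rewrite big1 // => j /and3P[Pi Pj ij]; have m2 : (m - 2 == 0)%N = false by lia.
by case: (x0 i j Pi Pj ij) => ->; rewrite expr0n ?m2 ?mul0r ?mulr0 mul0rn.
Qed.

Hypotheses (m_even : ~~ odd m) (m_ge2 : (2 <= m)%N).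

Lemma even_mixed_degree : ~~ odd (m - 2).
Proof. by rewrite oddB // (negPf m_even). Qed.

Lemma coupled_value_ge (K : realDomainType) (x : 'I_n -> K) (i : 'I_n) :
  x i ^+ m *+ c i <= coupled_value x.
Proof.
rewrite /coupled_value (bigD1 i) //= -addrA lerDl addr_ge0 //.
  by apply: sumr_ge0 => j _; rewrite mulrn_wge0 // exprn_even_ge0.
apply: sumr_ge0 => j _; apply: sumr_ge0 => k _.
by rewrite mulrn_wge0 // mulr_ge0 ?sqr_ge0 // exprn_even_ge0 ?even_mixed_degree.
Qed.

Lemma coupled_value_ge0 (K : realDomainType) (x : 'I_n -> K) : 0 <= coupled_value x.
Proof.
apply: addr_ge0; apply: sumr_ge0 => j _; first by rewrite mulrn_wge0 // exprn_even_ge0.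
apply: sumr_ge0 => k _.
by rewrite mulrn_wge0 // mulr_ge0 ?sqr_ge0 // exprn_even_ge0 ?even_mixed_degree.
Qed.

Lemma coupled_value_ge_mixed (K : realDomainType) (x : 'I_n -> K) (i j : 'I_n) :
  P i -> P j -> i != j -> (x i ^+ 2 * x j ^+ (m - 2)) *+ D <= coupled_value x.
Proof.
move=> Pi Pj ij; have mixed_ge0 (k l : 'I_n) : 0 <= (x k ^+ 2 * x l ^+ (m - 2)) *+ D.
  by rewrite mulrn_wge0 // mulr_ge0 ?sqr_ge0 // exprn_even_ge0 ?even_mixed_degree.
rewrite /coupled_value ler_wpDl //.
  by apply: sumr_ge0 => k _; rewrite mulrn_wge0 // exprn_even_ge0.
rewrite (bigD1 i) //= ler_wpDr //.
  by apply: sumr_ge0 => k _; apply: sumr_ge0 => l _.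
by rewrite (bigD1 j) ?Pi ?Pj //= lerDl; apply: sumr_ge0 => k _.
Qed.

Lemma coupled_form_posdef (R : realType) :
  (forall i, 0 < c i)%N -> posdef R coupled_form.
Proof.
move=> c_gt0 x [i xi_neq0]; rewrite coupled_form_map_meval.
apply: lt_le_trans (coupled_value_ge x i).
by rewrite mulrn_wgt0 // exprn_even_gt0 ?xi_neq0 ?orbT.
Qed.

End Form.

Lemma homog_meval_scale (n d : nat) (Q : {mpoly int[n]}) (b : int) (x : 'I_n -> int) :
  Q \is d.-homog -> Q.@[fun i => b * x i] = b ^+ d * Q.@[x].
Proof.
move=> /dhomogP Q_homog; rewrite !mevalE mulr_sumr !big_seq; apply: eq_bigr => u u_Q.
rewrite mulrCA; congr (_ * _); rewrite -(Q_homog u u_Q) /= mdegE -prodrXr -big_split /=.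
by apply: eq_bigr => i _; rewrite exprMn.
Qed.

Lemma mem_largest (A : {fset int}) (a : int) : a \in A -> (`|a| <= largest A)%N.
Proof. by move=> aA; apply: (leq_bigmax_seq _ aA). Qed.

(** * The form attached to a set of exceptions *)

Section Exceptions.
Variables (A : {fset int}) (m : nat).
Hypotheses (A_pos : forall a : int, a \in A -> 0 < a)
  (m_gt2 : (2 < m)%N) (m_even : ~~ odd m).

Lemma values_power_closed (n : nat) (Q : {mpoly int[n]}) :
    Q \is m.-homog -> values Q = nonneg_off A ->
  forall a b : int, a * b ^+ m \in A -> a \in A.
Proof.
move=> Q_homog Q_vals a b abA; apply: contraT => aA.
have ab_gt0 := A_pos abA.
have a_ge0 : 0 <= a.
  rewrite leNgt; apply: contraL ab_gt0 => /ltW a_le0.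
  by rewrite -leNgt mulr_le0_ge0 // exprn_even_ge0.
have : nonneg_off A a by [].
rewrite -Q_vals => -[x _ Qx].
have : values Q (a * b ^+ m).
  by exists (fun i => b * x i) => //; rewrite (homog_meval_scale _ _ Q_homog) Qx mulrC.
by rewrite Q_vals => -[_]; rewrite abA.
Qed.

Let B := largest A.
Let g := waring m.

(** Three blocks: [1, ..., B] with the exceptions replaced by [B + 1]; then [B + 2, ..., 2 B + 1];
    then [g] copies of [B + 1]. Only the first block is coupled, the other coefficients being
    already above [B]. *)
Definition exception_coef (i : nat) : nat :=
  if (i < B)%N then if i.+1%:Z \in A then B.+1 else i.+1
  else if (i < B + B)%N then i.+2 else B.+1.

Definition exception_form : {mpoly int[B + B + g]} :=
  coupled_form m B.+1 (fun i : 'I_(B + B + g) => (i < B)%N) exception_coef.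

Lemma exception_coef_gt0 (i : nat) : (0 < exception_coef i)%N.
Proof. by rewrite /exception_coef; do 3?case: ifP. Qed.

Lemma exception_coef_notin (i : nat) : (exception_coef i)%:Z \notin A.
Proof.
apply/negP => cA; have := mem_largest cA; rewrite -/B /= leqNgt => /negP; apply.
move: cA; rewrite /exception_coef; case: ltnP => [_|le_B]; last by case: ifP => // _; lia.
by case: ifP => [|-> //].
Qed.

(** A value in [A] is at most [B], so nonzero coordinates lie in the first block, and there is only
    one because of the coupling. The value is then [c b ^ m] with [c] a coefficient, and closedness
    would put [c] in [A]. *)
Lemma exception_form_values_sub : (forall a b : int, a * b ^+ m \in A -> a \in A) ->
  (values exception_form `<=` nonneg_off A)%classic.
Proof.
move=> A_closed _ [x _ <-]; have m_ge2 := ltnW m_gt2.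
rewrite coupled_form_meval; split; first exact: coupled_value_ge0.
apply/negP => vA; move: (mem_largest vA) (A_pos vA) => le_vB v_gt0.
have {}le_vB : coupled_value m B.+1 (fun i : 'I_(B + B + g) => (i < B)%N)
    exception_coef x <= B%:Z by rewrite -(gtz0_abs v_gt0) lez_nat.
have pow_ge1 (i : 'I_(B + B + g)) e : ~~ odd e -> x i != 0 -> 1 <= x i ^+ e.
  by move=> e_even xi; rewrite -gtz0_ge1 exprn_even_gt0 ?xi ?orbT.
have small i : x i != 0 -> (i < B)%N && (exception_coef i <= B)%N.
  move=> xi; have le_cB : (exception_coef i <= B)%N.
    rewrite -lez_nat (le_trans _ le_vB) //.
    apply: le_trans (coupled_value_ge _ _ _ m_even m_ge2 x i).
    by rewrite -natz lerMn2r pow_ge1 ?orbT.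
  rewrite le_cB andbT; move: le_cB; rewrite /exception_coef; do 3?case: ifP => //; lia.
have uncoupled (i j : 'I_(B + B + g)) : (i < B)%N -> (j < B)%N -> i != j -> x i = 0 \/ x j = 0.
  move=> lt_iB lt_jB ij; have [xi|xi] := eqVneq (x i) 0; first by left.
  have [xj|xj] := eqVneq (x j) 0; first by right.
  have := coupled_value_ge_mixed B.+1 (P := fun i : 'I_(B + B + g) => (i < B)%N)
    exception_coef m_even m_ge2 x lt_iB lt_jB ij.
  move=> /le_trans/(_ le_vB); rewrite leNgt => /negP[].
  apply: (@lt_le_trans _ _ (1 *+ B.+1)); first by rewrite natz ltz_nat.
  by rewrite lerMn2r mulr_ege1 ?pow_ge1 ?(even_mixed_degree m_even m_ge2) ?orbT.
rewrite coupled_value_diag // in vA v_gt0.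
have [i xi|x0] := pickP (fun i => x i != 0); last first.
  move: v_gt0; rewrite big1 ?ltxx // => i _.
  by have /negbFE/eqP -> := x0 i; rewrite expr0n gtn_eqF ?mul0rn // ltnW // ltnW.
have [lt_iB _] := andP (small i xi).
move: vA; rewrite (bigD1 i) //= big1 ?addr0 => [|j ji]; last first.
  suff -> : x j = 0 by rewrite expr0n gtn_eqF ?mul0rn // ltnW // ltnW.
  apply/eqP; apply: contraT => xj; have [lt_jB _] := andP (small j xj).
  by case: (uncoupled j i lt_jB lt_iB ji) => /eqP; rewrite ?(negPf xi) ?(negPf xj).
rewrite -mulr_natl natz => /A_closed; apply/negP.
exact: exception_coef_notin.
Qed.

Lemma exception_coef_id (a : nat) :
  (0 < a <= B)%N -> a%:Z \notin A -> exception_coef a.-1 = a.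
Proof.
by move=> /andP[a_gt0 le_aB] aA; rewrite /exception_coef prednK // le_aB (negPf aA).
Qed.

Lemma sum_nth_pow (s : seq nat) (h : nat) : (size s <= h)%N ->
  \sum_(k < h) (nth 0%N s k)%:Z ^+ m = (\sum_(x <- s) x ^ m)%N%:Z.
Proof.
move=> le_sh; rewrite -natz natr_sum (big_nth 0%N) big_mkord.
rewrite (big_ord_widen h (fun k => ((nth 0%N s k) ^ m)%:R)) // [RHS]big_mkcond /=.
apply: eq_bigr => k _; rewrite natrX natz; case: ltnP => // le_sk.
by rewrite nth_default // expr0n gtn_eqF // ltnW // ltnW.
Qed.

(** An [a] in [1, ..., B] outside [A] is the value at a unit vector. Above [B], division gives
    [a = q (B + 1) + r]; if [r > 0], one [B + 1] joins [r] in a second-block coefficient, and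
    Waring's theorem handles the remaining multiple of [B + 1]. *)
Lemma exception_form_values_sup :
  (nonneg_off A `<=` values exception_form)%classic.
Proof.
have m_gt0 : (0 < m)%N by rewrite ltnW // ltnW.
move=> a [a_ge0 aA]; rewrite -(gez0_abs a_ge0) in aA *.
move: `|a|%N aA => {a a_ge0} a aA.
have diag (x : 'I_(B + B + g) -> int) :
    (forall i j : 'I_(B + B + g), (i < B)%N -> (j < B)%N -> i != j -> x i = 0 \/ x j = 0) ->
    \sum_i x i ^+ m *+ exception_coef i = a%:Z -> values exception_form a%:Z.
  move=> x0 x_sum; exists x => //.
  by rewrite coupled_form_meval (coupled_value_diag _ _ m_gt2 x0).
have [a0|a_gt0] := posnP a.
  apply: (diag (fun=> 0)) => [i j _ _ _|]; first by left.
  by rewrite big1 ?a0 // => i _; rewrite expr0n gtn_eqF ?mul0rn.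
have [le_aB|lt_Ba] := leqP a B.
  have lt_a : (a.-1 < B + B + g)%N by lia.
  apply: (diag (fun i => (i == Ordinal lt_a)%:R)) => [i j _ _ ij|].
    case: eqVneq => [i_eq|]; last by left.
    by right; rewrite -i_eq eq_sym (negPf ij).
  rewrite (bigD1 (Ordinal lt_a)) //= eqxx expr1n exception_coef_id ?a_gt0 // natz.
  by rewrite big1 ?addr0 // => i /negPf ->; rewrite expr0n gtn_eqF ?mul0rn.
pose q := (a %/ B.+1)%N; pose r := (a %% B.+1)%N.
have lt_r : (r < B.+1)%N by rewrite ltn_mod.
have q_gt0 : (0 < q)%N by rewrite divn_gt0.
pose N := (q - (0 < r))%N.
have [s [le_s s_sum]] : exists s : seq nat, (size s <= g)%N /\ (\sum_(x <- s) x ^ m)%N = N.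
  have [->|N_gt0] := posnP N; first by exists [::]; rewrite big_nil.
  exact: (waringP m_gt0 N_gt0).
(* In the second block the coefficient [B + 1 + r] sits at index [B + r - 1]; for [r = 0] no index
   of the block matches. *)
pose x (i : nat) : int := if (i < B)%N then 0 else
  if (i < B + B)%N then (i.+1 == B + r)%N%:R else (nth 0%N s (i - (B + B)))%:Z.
apply: (diag (fun i => x i)) => [i j lt_iB _ _|]; first by left; rewrite /x lt_iB.
rewrite !big_split_ord /=.
have -> : \sum_(i < B) x i ^+ m *+ exception_coef i = 0.
  by apply: big1 => i _; rewrite /x ltn_ord expr0n gtn_eqF ?mul0rn.
have -> : \sum_(k < g) x (B + B + k)%N ^+ m *+ exception_coef (B + B + k)%N =
    N%:Z *+ B.+1.
  rewrite -s_sum -(sum_nth_pow le_s) -sumrMnl; apply: eq_bigr => k _.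
  have nlt_B : (B + B + k < B)%N = false by lia.
  have nlt_2B : (B + B + k < B + B)%N = false by lia.
  by rewrite /x /exception_coef nlt_B nlt_2B addKn.
have -> : \sum_(i < B) x (B + i)%N ^+ m *+ exception_coef (B + i)%N =
    ((0 < r) * (B.+1 + r))%N%:Z.
  have term (i : 'I_B) : x (B + i)%N ^+ m *+ exception_coef (B + i)%N =
      if i.+1 == r then (B.+1 + r)%N%:Z else 0.
    have nlt_B : (B + i < B)%N = false by lia.
    rewrite /x /exception_coef nlt_B ltn_add2l ltn_ord -addnS eqn_add2l.
    case: eqP => [<-|_]; last by rewrite expr0n gtn_eqF ?mul0rn.
    by rewrite expr1n natz; congr Posz; lia.
  under eq_bigr => i _ do rewrite term.
  rewrite -big_mkcond /=; have [->|r_gt0] := posnP r; first by rewrite big1.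
  have lt_rB : (r.-1 < B)%N by lia.
  rewrite (big_pred1 (Ordinal lt_rB)) ?mul1n // => i.
  by rewrite /= -(inj_eq val_inj) /= -[RHS]eqSS prednK.
rewrite add0r -mulr_natr natz -PoszM -PoszD; congr Posz.
have := divn_eq a B.+1; rewrite -/q -/r /N; case: (posnP r) => [->|r_gt0] a_eq.
  by rewrite /= mul0n subn0 add0n a_eq addn0.
by rewrite /= mul1n mulnBl mul1n a_eq; move: q_gt0; case: (q) => // q' _; lia.
Qed.

Lemma exception_form_values : (forall a b : int, a * b ^+ m \in A -> a \in A) ->
  values exception_form = nonneg_off A.
Proof.
move=> A_closed; apply/seteqP; split; first exact: exception_form_values_sub.
exact: exception_form_values_sup.
Qed.

Lemma exception_form_posdef (R : realType) : posdef_form R m exception_form.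
Proof.
split; first exact/coupled_form_homog/ltnW.
by apply: coupled_form_posdef => [||i] //; [exact: ltnW | exact: exception_coef_gt0].
Qed.

(** Equivalent to [B < B g + 1], which holds since [g >= 1]. *)
Lemma exception_form_rank : (B + B + g < (B + 1) * (g + 1))%N.
Proof. by have := waring_gt0 (ltnW (ltnW m_gt2)); rewrite -/g; nia. Qed.

End Exceptions.

Theorem theorem3p4 (R : realType) (A : {fset int}) (m : nat)
    (A_pos : forall a : int, a \in A -> 0 < a)
    (m_gt2 : (2 < m)%N) (m_even : ~~ odd m) :
  ((exists (n : nat) (Q : {mpoly int[n]}),
      posdef_form R m Q /\ values Q = nonneg_off A)
   <->
   (forall a b : int, a * b ^+ m \in A -> a \in A))
  /\
  ((exists (n : nat) (Q : {mpoly int[n]}),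
      posdef_form R m Q /\ values Q = nonneg_off A) ->
   exists (n : nat) (Q : {mpoly int[n]}),
      [/\ posdef_form R m Q, values Q = nonneg_off A
        & (n < (largest A + 1) * (waring m + 1))%N]).
Proof.
have closed : (exists (n : nat) (Q : {mpoly int[n]}),
    posdef_form R m Q /\ values Q = nonneg_off A) ->
    forall a b : int, a * b ^+ m \in A -> a \in A.
  by move=> [n [Q [[Q_homog _] Q_vals]]]; apply: values_power_closed Q_vals.
have form : (forall a b : int, a * b ^+ m \in A -> a \in A) ->
    [/\ posdef_form R m (exception_form A m),
        values (exception_form A m) = nonneg_off A
      & (largest A + largest A + waring m <
         (largest A + 1) * (waring m + 1))%N].
  move=> A_closed; split; first exact: exception_form_posdef.
    exact: exception_form_values.
  exact: exception_form_rank.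
split; last first.
  move=> /closed/form ?.
  by exists (largest A + largest A + waring m)%N, (exception_form A m).
split=> // /form[pos vals _].
by exists (largest A + largest A + waring m)%N, (exception_form A m).
Qed.
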